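(* Let $A$ be a curved $A_\infty$-algebra, with structure maps $m_k:A^{\otimes k}\to A$, $k\ge0$, that is a Banach space, and let $\gamma\in A_1$. Assume that the maps $\{m_k\}_{k=0}^\infty$ are continuous and that the series $$m_0^\gamma=\sum_{k=0}^\infty m_k(\gamma,\dots,\gamma),$$ $$m_n^\gamma(x_1,\dots,x_n)=\sum_{k=0}^\infty\sum_\sigma\chi(\sigma)\,m_{n+k}(y_{\sigma(1)},\dots,y_{\sigma(k)},y_{\sigma(k+1)},\dots,y_{\sigma(k+n)}),\qquad n\ge1,$$ are point-wise norm convergent. Here $y_1=\gamma,\dots,y_k=\gamma$, $y_{k+1}=x_1,\dots,y_{k+n}=x_n$, and the inner sum is over all $\sigma\in\mathbf S_{k+n}$ such that $\sigma^{-1}(1)<\dots<\sigma^{-1}(k)$ and $\sigma^{-1}(k+1)<\dots<\sigma^{-1}(k+n)$ (i.e. over all ways of inserting $k$ copies of $\gamma$ into the sequence $x_1,\dots,x_n$). Then these series define a curved $A_\infty$-structure on $A$.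
   Context: Graded vector spaces are non-negatively graded over a field $\mathbf k$ that is $\mathbb R$ or $\mathbb C$; $A_1$ is the degree $1$ part of $A$; the Koszul sign rule is used when applying graded maps to graded objects. A curved $A_\infty$-structure on a graded vector space $V$ is a family of linear maps $m_k:V^{\otimes k}\to V$ of degree $2-k$, $k=0,1,2,\dots$, satisfying for every $n\ge0$ $$\sum_{r+s+t=n}(-1)^{r+st}\,m_{r+t+1}(\mathbf 1_V^{\otimes r}\otimes m_s\otimes\mathbf 1_V^{\otimes t})=0;$$ a curved $A_\infty$-algebra is a graded vector space with such a structure, and $m_0$ also denotes the element $m_0(1)\in V_2$. For homogeneous $y_1,\dots,y_N$ and $\sigma\in\mathbf S_N$, $\chi(\sigma)=\mathrm{sgn}(\sigma)\,\epsilon(\sigma;y_1,\dots,y_N)$, where $\epsilon$ is the Koszul sign obtained when passing from $y_1,\dots,y_N$ to $y_{\sigma(1)},\dots,y_{\sigma(N)}$.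
   Formalization: The sign in the curved A-infinity relations is (-1)^(rs+t) instead of (-1)^(r+st), with which the claim is false (equivalent up to m_k -> (-1)^(k(k-1)/2) m_k); each graded component of the Banach space A is assumed closed, without which m_0^gamma may leave degree 2. *)

(* Defs.v *)
From HB Require Import structures.
From mathcomp Require Import all_boot all_order all_algebra all_fingroup.
From mathcomp Require Import complex.
From mathcomp Require Import all_classical all_reals all_analysis.

Set Implicit Arguments.
Unset Strict Implicit.
Unset Printing Implicit Defensive.

Import Order.TTheory GRing.Theory Num.Theory.
Import numFieldNormedType.Exports.

Local Open Scope classical_set_scope.
Local Open Scope ring_scope.

Inductive real_or_complex (R : realType) : numFieldType -> Prop :=
  | Scalars_real : real_or_complex R R
  | Scalars_complex : real_or_complex R (complex R).

(* V is the (algebraic) direct sum of the subspaces A 0, A 1, A 2, ... *)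
Definition is_grading (K : numFieldType) (V : lmodType K)
    (A : nat -> submodClosed V) : Prop :=
  (forall x : V, exists n (c : nat -> V),
      (forall i, c i \in A i) /\ x = \sum_(i < n) c i) /\
  (forall n (c : nat -> V), (forall i, c i \in A i) ->
      \sum_(i < n) c i = 0 -> forall i, (i < n)%N -> c i = 0).

(* Non-negative grading: the components of negative degree vanish. *)
Definition in_degree (K : numFieldType) (V : lmodType K)
    (A : nat -> submodClosed V) (z : int) (v : V) : Prop :=
  match z with
  | Posz n => v \in A n
  | Negz _ => v = 0
  end.

(* x is a list of homogeneous elements, and d lists their degrees. *)
Definition homogeneous (K : numFieldType) (V : lmodType K)
    (A : nat -> submodClosed V) (d : seq nat) (x : seq V) : bool :=
  all2 (fun e v => v \in A e) d x.

(* A family m of maps m_k : V^k -> V, which stand for the linear maps on the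
   k-fold tensor power of V; the element m_0 is the value of m 0 at the only
   point of V^0. [multi_app m x] is m_k(x_1, ..., x_k) for x a list of
   length k. *)
Definition multi_app (K : numFieldType) (V : lmodType K)
    (m : forall k, ('I_k -> V) -> V) (x : seq V) : V :=
  m (size x) (fun i => x`_i).

Definition multilinear (K : numFieldType) (V : lmodType K) (k : nat)
    (f : ('I_k -> V) -> V) : Prop :=
  forall (x : 'I_k -> V) (i : 'I_k), linear (fun u : V => f (dfwith x i u)).

(* The value on x_1 (x) ... (x) x_n, the x_i being homogeneous of degrees d_i,
   of the left-hand side
     \sum_(r + s + t = n) (-1)^(r s + t) m_(r+t+1) (1^r (x) m_s (x) 1^t)
   of the n-th relation. Moving m_s, of degree 2 - s, past x_1, ..., x_r
   contributes the Koszul sign (-1)^(s (d_1 + ... + d_r)).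

   Sign convention: the other usual exponent, r + s t, is obtained by replacing
   every m_k by (-1)^(k (k - 1) / 2) m_k. With the exponent r s + t, the maps
   m_k twisted by an element gamma of degree 1 are given by the sums below
   without any further sign; with r + s t, the k-th term of the n-th series
   needs the extra factor (-1)^(k (k - 1) / 2 + n k). *)
Definition Ainfty_lhs (K : numFieldType) (V : lmodType K)
    (m : forall k, ('I_k -> V) -> V) (d : seq nat) (x : seq V) : V :=
  let n := size x in
  \sum_(r < n.+1) \sum_(s < (n - r).+1)
    let t := (n - r - s)%N in
    (-1) ^+ (r * s + t + s * sumn (take r d)) *:
      multi_app m (take r x ++ multi_app m (take s (drop r x))
                     :: drop (r + s) x).

Record curved_Ainfty (K : numFieldType) (V : lmodType K)
    (A : nat -> submodClosed V) (m : forall k, ('I_k -> V) -> V) : Prop := {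
  Ainfty_multilinear : forall k, multilinear (m k);
  (* m_k has degree 2 - k *)
  Ainfty_degree : forall (d : seq nat) (x : seq V), homogeneous A d x ->
    in_degree A ((sumn d)%:Z + 2 - (size x)%:Z) (multi_app m x);
  Ainfty_relation : forall (d : seq nat) (x : seq V), homogeneous A d x ->
    Ainfty_lhs m d x = 0
}.

(* The Koszul sign of the passage from y_1, ..., y_N, of degrees d_1, ..., d_N,
   to y_(s 1), ..., y_(s N): a factor (-1)^(d_a d_b) for every pair of elements
   y_a, y_b whose order is exchanged. *)
Definition koszul_sign (K : numFieldType) (N : nat) (s : 'S_N) (d : seq nat) : K :=
  \prod_(i < N) \prod_(j < N | (i < j)%N && (s j < s i)%N)
    (-1) ^+ (nth 0%N d (s i) * nth 0%N d (s j)).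

Definition chi (K : numFieldType) (N : nat) (s : 'S_N) (d : seq nat) : K :=
  (-1) ^+ s * koszul_sign K s d.

(* s^-1 is increasing on the first k indices and on the remaining ones. *)
Definition unshuffle (k N : nat) (s : 'S_N) : bool :=
  [forall i : 'I_N, forall j : 'I_N,
     ((i < j)%N && ((j < k)%N || (k <= i)%N)) ==> (s^-1%g i < s^-1%g j)%N].

(* The k-th term of the series m_n^gamma(x_1, ..., x_n), for x homogeneous of
   degrees d and gamma of degree 1. *)
Definition twisted_term (K : numFieldType) (V : lmodType K)
    (m : forall k, ('I_k -> V) -> V) (gamma : V)
    (d : seq nat) (x : seq V) (k : nat) : V :=
  if x is [::] then multi_app m (nseq k gamma) else
  let y := nseq k gamma ++ x in
  let dy := nseq k 1%N ++ d in
  \sum_(s : 'S_(k + size x) | unshuffle k s)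
    chi K s dy *: m (k + size x)%N (fun i => y`_(s i)).

(* Main.v *)
Require Import Defs.
From HB Require Import structures.
From mathcomp Require Import all_boot all_order all_algebra all_fingroup.
From mathcomp Require Import complex.
From mathcomp Require Import all_classical all_reals all_analysis.
From mathcomp Require Import zify.

Set Implicit Arguments.
Unset Strict Implicit.
Unset Printing Implicit Defensive.

Import Order.TTheory GRing.Theory Num.Theory.
Import numFieldNormedType.Exports.

Local Open Scope classical_set_scope.
Local Open Scope ring_scope.

(** Call an element of degree i even or odd according to i - 1, as in the
    suspension of A; then gamma is even. Let tau be the operator that
    multiplies A_i by (-1)^(i+1), and let b(x_1, ..., x_n) be the value of m_n
    on the arguments tau^(n-j)(x_j). All signs disappear into tau: the
    relations of the structure become
      sum_(r, s) b(tau x_1, ..., tau x_r, b(x_(r+1), ..., x_(r+s)), ...) = 0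
    ([bracket_relation], [Ainfty_lhs_bracket_relation]), and the k-th term of
    the n-th twisted series becomes the sum T_k(x), with coefficients 1, of b
    over all insertions of k copies of gamma into x ([insert_sum],
    [twisted_term_insert_sum]); no sign arises since tau gamma = gamma.

    Algebra. Cutting a word obtained by inserting copies of gamma into x
    amounts to cutting x and distributing the copies over the pieces
    ([insertions_split]). Hence the sum of the relation over all insertions of
    N copies of gamma is the sum over k + l = N of
      a_(k,l) = sum_(r, s) T_k(tau x', T_l(x''), x'''),  x = x' x'' x'''
    ([bracket_relation_insertions]), and every antidiagonal sum of the double
    series a vanishes.

    Analysis. The relation for the twisted brackets says that the iterated sum
    (first over l, then over k) of a vanishes. The series may converge
    only conditionally, and then this sum cannot be rearranged into antidiagonals.
    However, x being homogeneous, the vectors T_l(x'') stay in one graded piece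
    A_e, a Banach space, and the partial sums over k of u |-> T_k(tau x', u,
    x''') are continuous linear maps on A_e which converge pointwise. By
    [uniform_boundedness] they are uniformly bounded, so the rectangular partial
    sums F_(i,j) of a are bounded and converge, as i and j tend to infinity
    independently, to the iterated sum ([nested_double_limit]). Now the sum of
    the M + 1 numbers F_(i,j) with i + j = M is a combination of
    antidiagonal sums of a, so it is 0 ([square_partial_sums_cancel]); but the
    mean of these numbers tends to the limit of F. This is the argument by which
    the Cauchy product of convergent series is Cesaro summable to the product
    of the sums ([bounded_double_limit_antidiagonal]).

    Elements that are not homogeneous are finite sums of homogeneous ones, and
    tau is defined on them, which extends the convergence and makes the sums
    multilinear on all of V. *)

(** * Inserting copies of one letter into a word *)

Section Insertions.
Variables (T : Type) (g : T).

(** A list and not a set: when [g] is itself a letter of [x], different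
    insertions may give equal words, and each of them counts. *)
Fixpoint insertions (k : nat) : seq T -> seq (seq T) :=
  fix ins x := match k, x with
  | 0, _ => [:: x]
  | k'.+1, [::] => map (cons g) (insertions k' [::])
  | k'.+1, a :: x' =>
      map (cons a) (ins x') ++ map (cons g) (insertions k' (a :: x'))
  end.

Lemma insertions0 x : insertions 0 x = [:: x].
Proof. by case: x. Qed.

Lemma insertions_nil k : insertions k [::] = [:: nseq k g].
Proof. by elim: k => //= k ->. Qed.

Lemma insertions_cons k a x :
  insertions k.+1 (a :: x) =
  map (cons a) (insertions k.+1 x) ++ map (cons g) (insertions k (a :: x)).
Proof. by []. Qed.

Variable W : nmodType.

Lemma big_insertions_cons k a x (F : seq T -> W) :
  \sum_(w <- insertions k.+1 (a :: x)) F w =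
  \sum_(w <- insertions k.+1 x) F (a :: w) +
  \sum_(w <- insertions k (a :: x)) F (g :: w).
Proof. by rewrite insertions_cons big_cat /= !big_map. Qed.

Lemma big_insertions_nil k (F : seq T -> W) :
  \sum_(w <- insertions k [::]) F w = F (nseq k g).
Proof. by rewrite insertions_nil big_seq1. Qed.

Lemma big_insertions0 x (F : seq T -> W) :
  \sum_(w <- insertions 0 x) F w = F x.
Proof. by rewrite insertions0 big_seq1. Qed.

(** Deconcatenation is multiplicative for shuffles: a cut of a word of
    [insertions g k x] is a cut of [x] together with insertions into its two
    parts. Both sides obey the same recursion on the first letter. *)
Lemma insertions_split k x (F : seq T -> seq T -> W) :
  \sum_(w <- insertions k x) \sum_(r < (size w).+1) F (take r w) (drop r w) =
  \sum_(p < (size x).+1) \sum_(i < k.+1)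
    \sum_(u <- insertions i (take p x)) \sum_(v <- insertions (k - i) (drop p x))
      F u v.
Proof.
elim: k x F => [|k IHk] x F.
  rewrite big_insertions0; apply: eq_bigr => p _.
  by rewrite big_ord1 subn0 !big_insertions0.
elim: x F => [|a x IHx] F.
  rewrite big_insertions_nil big_ord1 take0 drop0.
  rewrite [LHS]big_ord_recl take0 drop0 [RHS]big_ord_recl subn0.
  rewrite !big_insertions_nil; congr (_ + _).
  have := IHk [::] (fun u v => F (g :: u) v).
  rewrite big_insertions_nil big_ord1 take0 drop0 => ->.
  by apply: eq_bigr => i _; rewrite !big_insertions_nil.
rewrite big_insertions_cons.
have hd b w : \sum_(r < (size (b :: w)).+1) F (take r (b :: w)) (drop r (b :: w))
   = F [::] (b :: w) + \sum_(r < (size w).+1) F (b :: take r w) (drop r w).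
  by rewrite big_ord_recl take0 drop0.
under eq_bigr do rewrite hd.
under [X in _ + X]eq_bigr do rewrite hd.
rewrite !big_split /= addrACA.
rewrite (IHx (fun u v => F (a :: u) v)) (IHk _ (fun u v => F (g :: u) v)).
rewrite -(big_insertions_cons k a x (F [::])).
rewrite [RHS]big_ord_recl take0 drop0.
rewrite [X in _ = X + _]big_ord_recl subn0 !big_insertions0 -!addrA; congr (_ + _).
rewrite [X in _ + X = _]big_ord_recl take0 drop0.
rewrite [LHS]addrCA; congr (_ + _).
  apply: eq_bigr => i _; rewrite !big_insertions_nil.
  by [].
rewrite -big_split; apply: eq_bigr => p _ /=.
rewrite big_ord_recl [RHS]big_ord_recl !big_insertions0 subn0 -!addrA; congr (_ + _).
rewrite -big_split; apply: eq_bigr => i _ /=.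
by rewrite big_insertions_cons.
Qed.

(** The copies before and after a marked letter are distributed independently;
    the marked letter will be the value of the inner bracket. *)
Lemma insertions_cat k x1 y x3 (F : seq T -> W) :
  \sum_(w <- insertions k (x1 ++ y :: x3)) F w =
  \sum_(i < k.+1) \sum_(u <- insertions i x1)
    \sum_(v <- insertions (k - i) x3) F (u ++ y :: v).
Proof.
elim: k x1 F => [|k IHk] x1 F.
  by rewrite big_insertions0 big_ord1 subn0 !big_insertions0.
elim: x1 F => [|a x1 IHx] F.
  rewrite big_insertions_cons (IHk [::]) [RHS]big_ord_recl subn0 big_insertions0.
  congr (_ + _); apply: eq_bigr => i _.
  by rewrite !big_insertions_nil.
rewrite cat_cons big_insertions_cons IHx -cat_cons IHk.
rewrite big_ord_recl [RHS]big_ord_recl !big_insertions0 subn0 -!addrA.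
congr (_ + _); rewrite -big_split; apply: eq_bigr => i _ /=.
by rewrite big_insertions_cons.
Qed.

End Insertions.

Lemma insertions_map (T : Type) (f : T -> T) (g : T) k x : f g = g ->
  insertions g k (map f x) = map (map f) (insertions g k x).
Proof.
move=> fg; elim: k x => [|k IHk] x; first by rewrite !insertions0.
elim: x => [|a x IHx]; first by rewrite !insertions_nil /= fg map_nseq fg.
rewrite map_cons !insertions_cons IHx -(map_cons f) IHk map_cat -!map_comp.
by congr (_ ++ _); apply: eq_map => w /=; rewrite ?fg.
Qed.

Lemma size_insertions (T : eqType) (g : T) k x w :
  w \in insertions g k x -> size w = (k + size x)%N.
Proof.
elim: k x w => [|k IHk] x w; first by rewrite insertions0 inE => /eqP->.
elim: x w => [|a x IHx] w; first by rewrite insertions_nil inE => /eqP->; rewrite size_nseq addn0.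
rewrite insertions_cons mem_cat => /orP[]/mapP[v vin ->] /=.
  by rewrite (IHx _ vin) addnS.
by rewrite (IHk _ _ vin).
Qed.

Lemma exchange_big_triangle (W : nmodType) N (F : nat -> nat -> W) :
  \sum_(i < N.+1) \sum_(j < (N - i).+1) F i j =
  \sum_(j < N.+1) \sum_(i < (N - j).+1) F i j.
Proof.
(* Both orders of summation run over the pairs with i + j <= N. *)
have tri (G : nat -> nat -> W) : \sum_(i < N.+1) \sum_(j < (N - i).+1) G i j =
    \sum_(i < N.+1) \sum_(j < N.+1 | (i + j <= N)%N) G i j.
  apply: eq_bigr => i _.
  rewrite (big_ord_widen_cond N.+1 xpredT (fun j => G i j)) ?ltnS ?leq_subr //.
  by apply: eq_bigl => j /=; rewrite ltnS leq_subRL // -ltnS.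
rewrite (tri F) (tri (fun j i => F i j)) (exchange_big_dep xpredT) //=.
by apply: eq_bigr => j _; apply: eq_bigl => i; rewrite addnC.
Qed.

(** * Brackets, their quadratic relation and its insertions *)

Section ShiftedBrackets.
Variables (K : numFieldType) (V : lmodType K).

Definition slot_linear (b : seq V -> V) : Prop :=
  forall p q, linear (fun u : V => b (p ++ u :: q)).

Section SlotLinear.
Variable b : seq V -> V.
Hypothesis b_lin : slot_linear b.

Lemma slot0 p q : b (p ++ 0 :: q) = 0.
Proof.
by have := b_lin p q (-1) 0 0; rewrite scaler0 addr0 scaleN1r addNr.
Qed.

Lemma slotZ p q a u : b (p ++ a *: u :: q) = a *: b (p ++ u :: q).
Proof. by have := b_lin p q a u 0; rewrite slot0 !addr0. Qed.

Lemma slotD p q u v : b (p ++ (u + v) :: q) = b (p ++ u :: q) + b (p ++ v :: q).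
Proof. by have := b_lin p q 1 u v; rewrite !scale1r. Qed.

Lemma slot_sum p q I (r : seq I) (P : pred I) (F : I -> V) :
  b (p ++ (\sum_(i <- r | P i) F i) :: q) =
  \sum_(i <- r | P i) b (p ++ F i :: q).
Proof.
apply: (big_morph (fun u => b (p ++ u :: q))) => [u v|]; first exact: slotD.
exact: slot0.
Qed.

End SlotLinear.

Definition insert_sum (b : seq V -> V) (g : V) (k : nat) (x : seq V) : V :=
  \sum_(w <- insertions g k x) b w.

Lemma insert_sum_cat b g k p u q :
  insert_sum b g k (p ++ u :: q) =
  \sum_(i < k.+1) \sum_(w <- insertions g i p)
    \sum_(v <- insertions g (k - i) q) b (w ++ u :: v).
Proof. exact: insertions_cat. Qed.

Lemma insert_sum_slot_linear b g k :
  slot_linear b -> slot_linear (insert_sum b g k).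
Proof.
move=> b_lin p q a u v; rewrite !insert_sum_cat scaler_sumr -big_split /=.
apply: eq_bigr => i _; rewrite scaler_sumr -big_split /=.
apply: eq_bigr => w _; rewrite scaler_sumr -big_split /=.
by apply: eq_bigr => z _; rewrite b_lin.
Qed.

(** The relation satisfied by the brackets of a curved A-infinity algebra after
    suspension: [tau] carries the Koszul sign of moving the inner bracket, which
    is odd, past the first [r] arguments. *)
Definition bracket_relation (tau : V -> V) (b : seq V -> V) (x : seq V) : V :=
  \sum_(r < (size x).+1) \sum_(s < (size x - r).+1)
    b (map tau (take r x) ++ b (take s (drop r x)) :: drop (r + s) x).

(** The three parts of each term of the relation receive their insertions
    separately; the [l] copies in the middle part form the inner bracket, the
    other [N - l] the outer one. As [g] is fixed by [tau], applying [tau] before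
    or after the insertions is the same. *)
Lemma bracket_relation_insertions (tau : V -> V) (b : seq V -> V) (g : V) N x :
  slot_linear b -> tau g = g ->
  \sum_(w <- insertions g N x) bracket_relation tau b w =
  \sum_(r < (size x).+1) \sum_(s < (size x - r).+1) \sum_(l < N.+1)
    insert_sum b g (N - l)
      (map tau (take r x) ++
       insert_sum b g l (take s (drop r x)) :: drop (r + s) x).
Proof.
move=> b_lin tau_g.
pose D u (v : seq V) := \sum_(s < (size v).+1)
  b (map tau u ++ b (take s v) :: drop s v).
transitivity (\sum_(w <- insertions g N x)
   \sum_(r < (size w).+1) D (take r w) (drop r w)).
  apply: eq_bigr => w _; apply: eq_bigr => r _.
  rewrite /D size_drop; apply: eq_bigr => s _.
  by rewrite drop_drop addnC.
rewrite insertions_split; apply: eq_bigr => r _.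
have Dsplit k y u : \sum_(v <- insertions g k y) D u v =
    \sum_(s < (size y).+1) \sum_(j < k.+1) \sum_(v1 <- insertions g j (take s y))
      \sum_(v2 <- insertions g (k - j) (drop s y)) b (map tau u ++ b v1 :: v2).
  exact: (insertions_split g k y (fun v1 v2 => b (map tau u ++ b v1 :: v2))).
under eq_bigr do under eq_bigr do rewrite Dsplit.
under eq_bigr do rewrite exchange_big /=.
rewrite exchange_big size_drop /=; apply: eq_bigr => s _.
under eq_bigr do rewrite exchange_big /=.
have -> : drop s (drop r x) = drop (r + s) x by rewrite drop_drop addnC.
rewrite (exchange_big_triangle N (fun i j => \sum_(u <- insertions g i (take r x))
   \sum_(v1 <- insertions g j (take s (drop r x)))
   \sum_(v2 <- insertions g (N - i - j) (drop (r + s) x))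
      b (map tau u ++ b v1 :: v2))).
apply: eq_bigr => l _; rewrite insert_sum_cat; apply: eq_bigr => i _.
rewrite insertions_map // big_map; apply: eq_bigr => u _.
rewrite exchange_big /= subnAC; apply: eq_bigr => v _.
by rewrite /insert_sum slot_sum.
Qed.

End ShiftedBrackets.

(** * Uniform boundedness on a closed subspace *)

(** The norm takes its values in the scalars, which are only partially ordered
    in the complex case; this is the form in which the real numbers enter. *)
Definition archimedean_scalars (K : numFieldType) : Prop :=
  forall x : K, 0 <= x -> exists n : nat, x < n%:R.

Lemma real_or_complex_archimedean (R : realType) (K : numFieldType) :
  real_or_complex R K -> archimedean_scalars K.
Proof.
case=> x x0; first by exists (Num.truncn x).+1; exact: truncnS_gt.
have /complex_realP[r xr] : x \is Num.real by rewrite realE x0.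
exists (Num.truncn r).+1.
by rewrite xr -(rmorph_nat (real_complex R)) ltcR truncnS_gt.
Qed.

Lemma cvgn_normP (K : numFieldType) (V : normedModType K) (u : nat -> V) (l : V) :
  u @ \oo --> l <->
  forall e : K, 0 < e -> exists N, forall n, (N <= n)%N -> `|l - u n| <= e.
Proof.
split=> [/cvgrPdist_le ul e e0|ul].
  by have [N _ HN] := ul e e0; exists N => n; apply: HN.
apply/cvgrPdist_le => e e0; have [N HN] := ul e e0.
by exists N => // n; apply: HN.
Qed.

Lemma submod_rpredB (K : numFieldType) (V : lmodType K) (A : submodClosed V) u v :
  u \in A -> v \in A -> u - v \in A.
Proof. by move=> uA vA; rewrite -scaleN1r rpredD // rpredZ. Qed.

Section UniformBoundedness.
Variables (K : numFieldType) (V : completeNormedModType K) (W : normedModType K).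
Hypothesis K_arch : archimedean_scalars K.

Definition bounded_on (A : {pred V}) (f : V -> W) : Prop :=
  exists2 C : K, 0 <= C & forall u, u \in A -> `|f u| <= C * `|u|.

Lemma bounded_on_sum (B : {pred V}) I (r : seq I) (h : I -> V -> W) :
  (forall i, bounded_on B (h i)) -> bounded_on B (fun u => \sum_(i <- r) h i u).
Proof.
move=> hB; elim: r => [|i r [C C0 rC]].
  by exists 0 => // u _; rewrite big_nil normr0 mul0r.
have [D D0 iD] := hB i; exists (D + C) => [|u uB]; first exact: addr_ge0.
rewrite big_cons mulrDl (le_trans (ler_normD _ _)) // lerD //.
  exact: iD.
exact: rC.
Qed.

Lemma le_two_pos (a b : K) : 0 < a -> 0 < b -> exists2 c, 0 < c & c <= a /\ c <= b.
Proof.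
move=> a0 b0.
by have [ab|/ltW ba] := real_leP (gtr0_real a0) (gtr0_real b0);
  [exists a|exists b].
Qed.

Variables (A : submodClosed V) (T : nat -> V -> W).
Hypothesis A_closed : closed [set v : V | v \in A].
Hypothesis T_linear : forall k, linear (T k).
Hypothesis T_bounded : forall k, bounded_on A (T k).
Hypothesis T_pointwise : forall u, u \in A ->
  exists C : nat, forall k, `|T k u| <= C%:R.

Let T_add k u v : T k (u + v) = T k u + T k v.
Proof. by have := T_linear k 1 u v; rewrite !scale1r. Qed.

Let T_0 k : T k 0 = 0.
Proof. by have := T_linear k (-1) 0 0; rewrite scaler0 addr0 scaleN1r addNr. Qed.

Let T_scale k a u : T k (a *: u) = a *: T k u.
Proof. by have := T_linear k a u 0; rewrite T_0 !addr0. Qed.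

Definition uniform_bound : Prop :=
  exists2 C : K, 0 <= C & forall k u, u \in A -> `|T k u| <= C * `|u|.

(** A bound for all the [T k] on one ball of [A] gives, by translation to the
    origin and scaling, a bound on the unit ball of [A]. *)
Lemma large_value_nearby : ~ uniform_bound ->
  forall x (rho : K) (n : nat), x \in A -> 0 < rho ->
  exists k u, [/\ u \in A, `|u - x| <= rho & n%:R < `|T k u|].
Proof.
move=> unb x rho n xA rho0; apply: contrapT => small; apply: unb.
have le_n k u : u \in A -> `|u - x| <= rho -> `|T k u| <= n%:R.
  move=> uA ux; rewrite real_leNgt ?normr_real ?realn //.
  by apply/negP => lt; apply: small; exists k, u.
exists ((n%:R + n%:R) / rho) => [|k u uA].
  by rewrite divr_ge0 ?addr_ge0 ?ler0n ?ltW.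
have [->|u0] := eqVneq u 0; first by rewrite T_0 !normr0 mulr0.
have nu : 0 < `|u| by rewrite normr_gt0.
pose v := (rho / `|u|) *: u.
have vA : v \in A by rewrite rpredZ.
have nv : `|v| = rho.
  by rewrite normrZ ger0_norm ?divr_ge0 ?ltW // divfK ?normr_eq0.
have Tv : `|T k v| <= n%:R + n%:R.
  have -> : T k v = T k (x + v) - T k x by rewrite T_add addrC addKr.
  apply: le_trans (ler_normB _ _) _; apply: lerD; apply: le_n => //.
  - by rewrite rpredD.
  - by rewrite addrC addKr nv.
  - by rewrite subrr normr0 ltW.
have r0 : 0 <= rho / `|u| by rewrite divr_ge0 // ltW.
move: Tv; rewrite T_scale normrZ ger0_norm //.
rewrite -ler_pdivlMl ?divr_gt0 // invf_div => /le_trans; apply.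
by rewrite mulrC mulrA mulrAC.
Qed.

(** If the maps were not uniformly bounded, [large_value_nearby] and continuity
    would give shrinking balls, each inside the previous one, such that some
    [T k] has norm at least [n] on the n-th ball. By completeness their centers
    converge; the limit is in [A] since [A] is closed, and the [T k] are not
    bounded there. The maps are bounded on the subspace [A] only, which need not
    be complemented, so this is done inside [V] with balls centered in [A]. *)
Lemma uniform_boundedness : uniform_bound.
Proof.
apply: contrapT => unb.
have large := large_value_nearby unb.
(* The estimate is required on the ball of twice the radius, since the limit
   of the centers will only be known to be within any larger radius. *)
pose next n (p q : V * K) := p.1 \in A -> 0 < p.2 ->
  [/\ q.1 \in A, 0 < q.2, `|q.1 - p.1| + q.2 <= p.2, q.2 <= n.+1%:R^-1 &
   exists k, forall v, v \in A -> `|v - q.1| <= q.2 + q.2 -> n%:R <= `|T k v|].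
have step (np : nat * (V * K)) : exists q, next np.1 np.2 q.
  case: np => n [x rho] /=.
  have [[xA rho0]|nx] := pselect (x \in A /\ 0 < rho); last first.
    by exists (0, 0) => xA rho0; case: nx.
  have h0 : 0 < rho / 2 by rewrite divr_gt0.
  have [k [u [uA ux lt_n]]] := large x (rho / 2) n xA h0.
  have [C C0 TC] := T_bounded k.
  have C10 : 0 < C + 1 by rewrite ltr_wpDl.
  have d0 : 0 < (`|T k u| - n%:R) / (C + 1) / 2.
    by rewrite !divr_gt0 ?subr_gt0.
  have [c1 c10 [c1a c1b]] := le_two_pos h0 d0.
  have n0 : 0 < n.+1%:R^-1 :> K by rewrite invr_gt0 ltr0n.
  have [c c0 [cc1 cn]] := le_two_pos c10 n0.
  exists (u, c) => /= _ _; split => //.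
    by rewrite [leRHS]splitr lerD // (le_trans cc1).
  exists k => v vA vu.
  have le1 : `|T k v - T k u| <= `|T k u| - n%:R.
    have -> : T k v - T k u = T k (v - u).
      by rewrite T_add -(scaleN1r u) T_scale scaleN1r.
    apply: le_trans (TC _ (submod_rpredB vA uA)) _.
    apply: (@le_trans _ _ (C * ((`|T k u| - n%:R) / (C + 1)))).
      rewrite ler_wpM2l // (le_trans vu) // [leRHS]splitr lerD //;
      exact: le_trans c1b.
    rewrite mulrCA ler_piMr //; first by rewrite subr_ge0 ltW.
    by rewrite ler_pdivrMr // mul1r lerDl ler01.
  (* `|T k v| >= `|T k u| - (`|T k u| - n) *)
  rewrite -(lerD2r (`|T k u| - n%:R)) addrC subrK.
  apply: le_trans (lerD (lexx _) le1).
  by rewrite distrC -lerBlDl lerB_dist.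
have [f fP] := choice step.
pose fix a n := if n is p.+1 then f (p, a p) else (0 : V, 1 : K).
have aA n : (a n).1 \in A /\ 0 < (a n).2.
  elim: n => [|n [IH1 IH2]]; first by rewrite /= rpred0 ltr01.
  by have [] := fP (n, a n) IH1 IH2.
have aS n : next n (a n) (a n.+1) by exact: fP (n, a n).
have nest n d : `|(a (n + d)%N).1 - (a n).1| + (a (n + d)%N).2 <= (a n).2.
  elim: d => [|d IHd]; first by rewrite addn0 subrr normr0 add0r.
  rewrite addnS; have [pA p0] := aA (n + d)%N.
  have [_ _ le_p _ _] := aS (n + d)%N pA p0.
  apply: le_trans IHd.
  apply: le_trans (lerD (lexx _) le_p).
  by rewrite addrA lerD2r addrC ler_distD.
have nest_le n k : (n <= k)%N -> `|(a k).1 - (a n).1| <= (a n).2.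
  move=> /subnKC <-; apply: le_trans (nest n (k - n)%N).
  by rewrite lerDl; case: (aA (n + (k - n))%N) => _ /ltW.
have : cvg ((fun n => (a n).1) @ \oo).
  apply: cauchy_cvg; apply: cauchy_exP => e e0.
  have [n ltn] := K_arch (ltW (divr_gt0 ltr01 e0)).
  exists (a n.+1).1; exists n.+1 => // k /= lek.
  rewrite -ball_normE /ball_ /= distrC.
  apply: le_lt_trans (nest_le _ _ lek) _.
  have [pA p0] := aA n; have [_ _ _ le_n _] := aS n pA p0.
  apply: le_lt_trans le_n _.
  have n0 : 0 < n.+1%:R :> K by rewrite ltr0n.
  rewrite -(ltr_pM2l n0) divff ?gt_eqF // -ltr_pdivrMr // (lt_trans ltn) //.
  by rewrite ltr_nat.
rewrite cvg_ex /= => -[l al].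
have lA : l \in A.
  apply: (closed_cvg (fun v => v \in A) A_closed _ l al).
  by apply: nearW => n; case: (aA n).
have [C CP] := T_pointwise lA.
have [pA p0] := aA C.+1.
have [qA q0 _ _ [k kP]] := aS C.+1 pA p0.
have : C.+1%:R <= `|T k l|.
  apply: kP => //; have /cvgn_normP/(_ _ q0)[N HN] := al.
  apply: le_trans (ler_distD (a (maxn N C.+2)).1 _ _) _.
  by rewrite lerD ?HN ?leq_maxl // nest_le // leq_maxr.
move=> /le_trans/(_ (CP k)).
by rewrite ler_nat ltnn.
Qed.

End UniformBoundedness.

Lemma linear_continuous_bounded_on (K : numFieldType)
    (V : completeNormedModType K) (h : V -> V) :
  linear h -> continuous h -> bounded_on predT h.
Proof.
move=> h_lin h_cont.
pose hl : {linear V -> V} := HB.pack h (GRing.isLinear.Build _ _ _ _ _ h_lin).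
have /linear_boundedP/pinfty_ex_gt0[C C0 hC] : bounded_near hl (nbhs (0 : V)).
  exact/linear_bounded_continuous.
by exists C => [|u _]; [exact: ltW|exact: hC].
Qed.

(** * Double sequences and their antidiagonals *)

(** In the sum of the rectangular partial sums over rectangles with
    half-perimeter [M], the term a_(k,l) with k + l < M occurs M - 1 - k - l times,
    which only depends on its antidiagonal. *)
Lemma square_partial_sums_cancel (W : nmodType) (a : nat -> nat -> W) :
  (forall N, \sum_(l < N.+1) a (N - l)%N l = 0) ->
  forall M, \sum_(j < M.+1) \sum_(k < M - j) \sum_(l < j) a k l = 0.
Proof.
move=> diag0.
(* The increment of the sum to be computed when [M] becomes [M + 1]. *)
have corner0 M : \sum_(j < M.+1) \sum_(l < j) a (M - j)%N l = 0.
  elim: M => [|M IHM]; first by rewrite big_ord1 big_ord0.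
  rewrite big_ord_recl big_ord0 add0r.
  under eq_bigr do rewrite lift0 subSS big_ord_recr /=.
  by rewrite big_split /= IHM diag0 addr0.
elim=> [|M IHM]; first by rewrite big_ord1 big_ord0.
rewrite big_ord_recr /= subnn big_ord0 addr0.
under eq_bigr => j _ do rewrite subSn -1?ltnS // big_ord_recr /=.
by rewrite big_split /= IHM corner0 addr0.
Qed.

Section DoubleLimits.
Variables (K : numFieldType) (V : normedModType K).
Hypothesis K_arch : archimedean_scalars K.

(** Convergence as both indices tend to infinity independently says nothing
    about single rows and columns, which meet every antidiagonal; hence the
    bound. *)
Definition bounded_double_limit (F : nat -> nat -> V) (l : V) : Prop :=
  (exists2 B : K, 0 <= B & forall i j, `|F i j| <= B) /\
  (forall e : K, 0 < e -> exists N, forall i j,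
     (N <= i)%N -> (N <= j)%N -> `|l - F i j| <= e).

Lemma bounded_double_limit0 : bounded_double_limit (fun _ _ => 0) 0.
Proof.
split; first by exists 0 => // i j; rewrite normr0.
by move=> e e0; exists 0 => i j _ _; rewrite subrr normr0 ltW.
Qed.

Lemma bounded_double_limitD F G l m :
  bounded_double_limit F l -> bounded_double_limit G m ->
  bounded_double_limit (fun i j => F i j + G i j) (l + m).
Proof.
move=> [[B B0 FB] Fl] [[C C0 GC] Gm]; split.
  exists (B + C) => [|i j]; first exact: addr_ge0.
  by apply: le_trans (ler_normD _ _) _; apply: lerD.
move=> e e0; have h0 : 0 < e / 2 by rewrite divr_gt0.
have [N HN] := Fl _ h0; have [N' HN'] := Gm _ h0.
exists (maxn N N') => i j; rewrite !geq_max => /andP[Ni N'i] /andP[Nj N'j].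
rewrite opprD addrACA [leRHS]splitr.
apply: le_trans (ler_normD _ _) _.
by apply: lerD; [apply: HN|apply: HN'].
Qed.

Lemma bounded_double_limit_sum n (F : 'I_n -> nat -> nat -> V) (l : 'I_n -> V) :
  (forall r, bounded_double_limit (F r) (l r)) ->
  bounded_double_limit (fun i j => \sum_(r < n) F r i j) (\sum_(r < n) l r).
Proof.
elim: n F l => [|n IHn] F l Fl.
  rewrite big_ord0; have -> : (fun i j => \sum_(r < 0) F r i j) = (fun _ _ => 0).
    by apply/funext => i; apply/funext => j; rewrite big_ord0.
  exact: bounded_double_limit0.
rewrite big_ord_recl; have -> : (fun i j => \sum_(r < n.+1) F r i j) =
    (fun i j => F ord0 i j + \sum_(r < n) F (lift ord0 r) i j).
  by apply/funext => i; apply/funext => j; rewrite big_ord_recl.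
apply: bounded_double_limitD => //.
exact: (IHn (fun r => F (lift ord0 r)) (fun r => l (lift ord0 r))).
Qed.

Lemma sum_lt_indicator (C : K) N n :
  \sum_(j < n) (if (j < N)%N then C else 0) = C *+ minn n N.
Proof.
elim: n => [|n IHn]; first by rewrite big_ord0 min0n.
rewrite big_ord_recr /= IHn; case: ltnP => nN.
  by rewrite (minn_idPl nN) mulrSr.
by rewrite addr0 (minn_idPr (leqW nN)).
Qed.

(** On the antidiagonal i + j = M all but boundedly many terms are near the
    limit, so their mean converges to it as [M] grows. *)
Lemma bounded_double_limit_antidiagonal F l : bounded_double_limit F l ->
  (forall M, \sum_(j < M.+1) F (M - j)%N j = 0) -> l = 0.
Proof.
move=> [[B B0 FB] Fl] F0; apply/eqP; apply: contrapT => /negP l0.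
have nl : 0 < `|l| by rewrite normr_gt0.
have h0 : 0 < `|l| / 2 by rewrite divr_gt0.
have [N HN] := Fl _ h0.
(* C bounds all the differences l - F i j; it is needed for the at most 2 N
   pairs of the antidiagonal that have a coordinate below N. *)
pose C := B + `|l|; have C0 : 0 <= C by rewrite addr_ge0.
(* With `|l| / 2 as the error, this bounds `|l| / 2 *+ M.+1 uniformly in M. *)
have bound M : `|l| *+ M.+1 <= (`|l| / 2) *+ M.+1 + (C *+ N + C *+ N).
  have -> : `|l| *+ M.+1 = `|\sum_(j < M.+1) (l - F (M - j)%N j)|.
    by rewrite sumrB F0 subr0 sumr_const card_ord normrMn.
  apply: le_trans (ler_norm_sum _ _ _) _.
  have ind n : C *+ minn n N <= C *+ N by rewrite ler_wpMn2l ?geq_minr.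
  apply: le_trans (lerD (lexx _) (lerD (ind M.+1) (ind M.+1))).
  have -> : (`|l| / 2) *+ M.+1 = \sum_(j < M.+1) (`|l| / 2).
    by rewrite sumr_const card_ord.
  rewrite -!sum_lt_indicator.
  rewrite [X in _ + (_ + X)](reindex_inj rev_ord_inj) /= -!big_split /=.
  apply: ler_sum => j _.
  have pos b : 0 <= (if b then C else 0 : K) by case: b.
  have triv : `|l - F (M - j)%N j| <= C.
    by rewrite /C [leRHS]addrC (le_trans (ler_normB _ _)) ?lerD.
  have [jN|Nj] := ltnP j N.
    apply: le_trans triv _.
    by rewrite addrCA lerDl addr_ge0 ?pos // ltW.
  have [MjN|NMj] := ltnP (M.+1 - j.+1) N.
    by rewrite add0r (le_trans triv) // lerDr ltW.
  by rewrite !addr0 HN.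
have [n ltn] := K_arch (divr_ge0 (addr_ge0 (addr_ge0 (mulrn_wge0 N C0)
  (mulrn_wge0 N C0)) (addr_ge0 (mulrn_wge0 N C0) (mulrn_wge0 N C0))) (ltW nl)).
move: ltn; rewrite ltr_pdivrMr // => ltn.
have := bound n; rewrite {1}[`|l|]splitr mulrnDl lerD2l => le2.
have := lerD le2 le2; rewrite -mulrnDl -splitr => /le_lt_trans/(_ ltn).
by rewrite mulr_natl ltr_pMn2l // ltnNge leqnSn.
Qed.

Lemma cvgn_bounded (y : nat -> V) (l : V) : y @ \oo --> l ->
  exists n : nat, forall j, `|y j| <= n%:R.
Proof.
move=> /cvgn_normP/(_ _ ltr01)[N HN].
have pos : 0 <= \sum_(i < N) `|y i| + (1 + `|l|).
  by rewrite !addr_ge0 ?ler01 ?sumr_ge0.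
have [n /ltW le_n] := K_arch pos; exists n => j; apply: le_trans le_n.
have [jN|Nj] := ltnP j N.
  rewrite (bigD1 (Ordinal jN)) //= -addrA lerDl.
  by rewrite !addr_ge0 ?ler01 ?sumr_ge0.
rewrite -[X in `|X|](subrK l) (le_trans (ler_normD _ _)) //.
by rewrite addrA lerD2r distrC (le_trans (HN j Nj)) // lerDr sumr_ge0.
Qed.

End DoubleLimits.

(** Equicontinuity turns the iterated limit into a joint limit:
    S_i(y_j) - S_i(y) is small uniformly in i. *)
Lemma uniform_bound_double_limit (K : numFieldType)
    (V : completeNormedModType K) (W : normedModType K) (A : submodClosed V)
    (S : nat -> V -> W) (y : nat -> V) (yl : V) (Sl : W) :
  archimedean_scalars K ->
  (forall k, linear (S k)) -> uniform_bound A S ->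
  (forall j, y j \in A) -> yl \in A -> y @ \oo --> yl -> (S^~ yl) @ \oo --> Sl ->
  bounded_double_limit (fun i j => S i (y j)) Sl.
Proof.
move=> K_arch S_lin [C C0 SC] yA ylA ycvg Scvg; split.
  have [n yn] := cvgn_bounded K_arch ycvg.
  exists (C * n%:R) => [|i j]; first by rewrite mulr_ge0.
  by apply: le_trans (SC _ _ (yA j)) _; rewrite ler_wpM2l.
move=> e e0; have h0 : 0 < e / 2 by rewrite divr_gt0.
have C10 : 0 < C + 1 by rewrite ltr_wpDl.
have d0 : 0 < e / 2 / (C + 1) by rewrite divr_gt0.
have [N HN] := (cvgn_normP _ _).1 Scvg _ h0.
have [N' HN'] := (cvgn_normP _ _).1 ycvg _ d0.
exists (maxn N N') => i j; rewrite !geq_max => /andP[Ni _] /andP[_ N'j].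
apply: le_trans (ler_distD (S i yl) _ _) _; rewrite [leRHS]splitr.
apply: lerD; first exact: HN.
have -> : S i yl - S i (y j) = S i (yl - y j).
  by have := S_lin i (-1) (y j) yl; rewrite !scaleN1r ![- _ + _]addrC => ->.
apply: le_trans (SC _ _ (submod_rpredB ylA (yA j))) _.
apply: (@le_trans _ _ (C * (e / 2 / (C + 1)))); first by rewrite ler_wpM2l ?HN'.
rewrite mulrCA ler_piMr //; first exact: ltW.
by rewrite ler_pdivrMr // mul1r lerDl ler01.
Qed.

(** * Absorbing the signs: the suspension *)

Section Signs.
Variables (K : numFieldType) (V : lmodType K) (A : nat -> submodClosed V).

(** The numbers of summands may differ, so the families are compared after
    extension by zero. *)
Lemma grading_sum_unique n1 n2 (c1 c2 : nat -> V) : is_grading A ->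
  (forall i, c1 i \in A i) -> (forall i, c2 i \in A i) ->
  \sum_(i < n1) c1 i = \sum_(i < n2) c2 i ->
  forall i, (if (i < n1)%N then c1 i else 0) = (if (i < n2)%N then c2 i else 0).
Proof.
move=> [_ indep] c1A c2A eq_sum i.
pose c j := (if (j < n1)%N then c1 j else 0) - (if (j < n2)%N then c2 j else 0).
have cA j : c j \in A j.
  have mem (b : bool) (v : V) : v \in A j -> (if b then v else 0) \in A j.
    by case: b => // _; rewrite rpred0.
  by rewrite /c -scaleN1r rpredD ?rpredZ ?mem.
have pad n (c' : nat -> V) : (n <= maxn i.+1 (maxn n1 n2))%N ->
    \sum_(j < maxn i.+1 (maxn n1 n2)) (if (j < n)%N then c' j else 0) =
    \sum_(j < n) c' j.
  by move=> le_n; rewrite (big_ord_widen _ c' le_n) [RHS]big_mkcond.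
have := indep (maxn i.+1 (maxn n1 n2)) c cA.
rewrite sumrB !pad ?leq_max ?leqnn ?orbT // eq_sum subrr => /(_ erefl i).
by rewrite leq_max leqnn => /(_ isT)/eqP; rewrite subr_eq0 => /eqP.
Qed.

(** The sign of the suspended degree, as an operator defined on all of [V];
    with it, brackets need no record of the degrees of their arguments. *)
Lemma grading_sign_operator : is_grading A ->
  exists2 tau : V -> V, linear tau &
    forall i v, v \in A i -> tau v = (-1) ^+ i.+1 *: v.
Proof.
move=> grA; have [dec _] := grA.
have decP v : exists nc : nat * (nat -> V),
    (forall i, nc.2 i \in A i) /\ v = \sum_(i < nc.1) nc.2 i.
  by have [n [c cP]] := dec v; exists (n, c).
have [nc ncP] := choice decP.
pose tau v := \sum_(i < (nc v).1) (-1) ^+ i.+1 *: (nc v).2 i.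
have tauE v n (c : nat -> V) : (forall i, c i \in A i) ->
    v = \sum_(i < n) c i -> tau v = \sum_(i < n) (-1) ^+ i.+1 *: c i.
  move=> cA vE; have [c'A v'E] := ncP v.
  have same := grading_sum_unique grA c'A cA (etrans (esym v'E) vE).
  (* Both decompositions of v are padded to the same length. *)
  pose N := maxn (nc v).1 n.
  rewrite /tau (big_ord_widen N (fun i => (-1) ^+ i.+1 *: (nc v).2 i)) ?leq_maxl //.
  rewrite [RHS](big_ord_widen N (fun i => (-1) ^+ i.+1 *: c i)) ?leq_maxr //.
  rewrite big_mkcond [RHS]big_mkcond; apply: eq_bigr => i _.
  have out (b : bool) (w : V) k :
      (if b then (-1) ^+ k *: w else 0) = (-1) ^+ k *: (if b then w else 0).
    by case: b; rewrite ?scaler0.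
  by rewrite !out same.
exists tau.
  move=> a u v; have [uA uE] := ncP u; have [vA vE] := ncP v.
  pose n := maxn (nc u).1 (nc v).1.
  pose cu i := if (i < (nc u).1)%N then (nc u).2 i else 0.
  pose cv i := if (i < (nc v).1)%N then (nc v).2 i else 0.
  have cuA i : cu i \in A i by rewrite /cu; case: ifP => // _; rewrite rpred0.
  have cvA i : cv i \in A i by rewrite /cv; case: ifP => // _; rewrite rpred0.
  have cuE : u = \sum_(i < n) cu i.
    by rewrite {1}uE (big_ord_widen n (nc u).2) ?leq_maxl // big_mkcond.
  have cvE : v = \sum_(i < n) cv i.
    by rewrite {1}vE (big_ord_widen n (nc v).2) ?leq_maxr // big_mkcond.
  rewrite (tauE u n cu) // (tauE v n cv) //.
  rewrite (tauE (a *: u + v) n (fun i => a *: cu i + cv i)).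
  - rewrite scaler_sumr -big_split; apply: eq_bigr => i _ /=.
    by rewrite scalerDr !scalerA mulrC.
  - by move=> i; rewrite rpredD ?rpredZ.
  - by rewrite big_split -scaler_sumr -cuE -cvE.
move=> i v vA; pose c j := if j == i then v else 0.
rewrite (tauE v i.+1 c).
- rewrite big_ord_recr /= big1 ?add0r => [|j _]; first by rewrite /c eqxx.
  by rewrite /c ltn_eqF ?scaler0.
- by move=> j; rewrite /c; case: eqP => [->|_] //; rewrite rpred0.
- rewrite big_ord_recr /= big1 ?add0r => [|j _]; first by rewrite /c eqxx.
  by rewrite /c ltn_eqF.
Qed.

Lemma signr_parity i j : odd i = odd j -> (-1) ^+ i = (-1) ^+ j :> K.
Proof. by move=> ij; rewrite -signr_odd ij signr_odd. Qed.

Lemma signK i (v : V) : (-1) ^+ i *: ((-1) ^+ i *: v) = v.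
Proof. by rewrite scalerA -exprD addnn -mul2n exprM sqrrN expr1n expr1n scale1r. Qed.

Lemma homogeneous_size d x : homogeneous A d x -> size d = size x.
Proof. by rewrite /homogeneous all2E => /andP[/eqP]. Qed.

Lemma homogeneous_cons e d u x :
  homogeneous A (e :: d) (u :: x) = (u \in A e) && homogeneous A d x.
Proof. by []. Qed.

Lemma homogeneous_cat d1 d2 x1 x2 : size d1 = size x1 ->
  homogeneous A (d1 ++ d2) (x1 ++ x2) =
  homogeneous A d1 x1 && homogeneous A d2 x2.
Proof.
elim: d1 x1 => [|e d1 IHd] [|u x1] // [sz].
by rewrite !cat_cons !homogeneous_cons IHd // andbA.
Qed.

Lemma homogeneous_take_drop r d x :
  homogeneous A d x ->
  homogeneous A (take r d) (take r x) && homogeneous A (drop r d) (drop r x).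
Proof.
move=> dx; have sz := homogeneous_size dx.
by rewrite -homogeneous_cat ?cat_take_drop // !size_take sz.
Qed.

(** The exponent of the sign that [spread_signs] below produces on elements of
    degrees [d]: the usual exponent sum_i (n - i) (d_i + 1) of the suspension
    isomorphism. *)
Fixpoint shift_sign (d : seq nat) : nat :=
  if d is e :: d' then (size d' * e.+1 + shift_sign d')%N else 0.

Lemma shift_sign_cat d1 d2 : shift_sign (d1 ++ d2) =
  (shift_sign d1 + size d2 * (sumn d1 + size d1) + shift_sign d2)%N.
Proof.
elim: d1 => [|e d1 IHd]; first by rewrite muln0.
rewrite /= IHd size_cat; lia.
Qed.

Variable tau : V -> V.
Hypothesis tau_linear : linear tau.
Hypothesis tau_sign : forall i v, v \in A i -> tau v = (-1) ^+ i.+1 *: v.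

Lemma iter_sign_operator k e v : v \in A e ->
  iter k tau v = (-1) ^+ (k * e.+1) *: v.
Proof.
move=> vA; elim: k => [|k IHk]; first by rewrite mul0n scale1r.
by rewrite iterS IHk (@tau_sign e) ?rpredZ // scalerA -exprD mulSn.
Qed.

Lemma iter_sign_linear k : linear (iter k tau).
Proof.
elim: k => [|k IHk] a u v; first by [].
by rewrite !iterS IHk tau_linear.
Qed.

(** Entry number j of n is acted upon n - j times: in the suspension
    isomorphism, the j-th argument is moved past n - j suspensions. *)
Fixpoint spread_signs (x : seq V) : seq V :=
  if x is u :: x' then iter (size x') tau u :: spread_signs x' else [::].

Lemma size_spread_signs x : size (spread_signs x) = size x.
Proof. by elim: x => //= u x ->. Qed.

Lemma spread_signs_cat p n : exists p', forall q, size q = n ->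
  spread_signs (p ++ q) = p' ++ spread_signs q.
Proof.
elim: p => [|u p [p' p'P]]; first by exists [::].
exists (iter (size p + n) tau u :: p') => q qn.
by rewrite /= p'P // size_cat qn.
Qed.

Lemma spread_signs_slot_linear (f : seq V -> V) :
  slot_linear f -> slot_linear (f \o spread_signs).
Proof.
move=> f_lin p q a u v /=; have [p' p'P] := spread_signs_cat p (size q).+1.
by rewrite !p'P //= iter_sign_linear f_lin.
Qed.

Lemma map_sign_homogeneous d x : homogeneous A d x ->
  homogeneous A d (map tau x).
Proof.
elim: d x => [|e d IHd] [|u x] //; rewrite ![_ (_ :: _)]/= !homogeneous_cons => /andP[uA dx].
by rewrite (tau_sign uA) rpredZ // IHd.
Qed.

Lemma sign_operator_sum n (c : nat -> V) : (forall i, c i \in A i) ->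
  tau (\sum_(i < n) c i) = \sum_(i < n) (-1) ^+ i.+1 *: c i.
Proof.
move=> cA; have tau0 : tau 0 = 0.
  by have := tau_linear (-1) 0 0; rewrite scaler0 addr0 scaleN1r addNr.
have tauD u v : tau (u + v) = tau u + tau v.
  by have := tau_linear 1 u v; rewrite !scale1r.
rewrite (big_morph tau tauD tau0); apply: eq_bigr => i _.
exact: tau_sign.
Qed.

Lemma sign_operatorK : is_grading A -> involutive tau.
Proof.
move=> [dec _] v; have [n [c [cA ->]]] := dec v.
rewrite (sign_operator_sum n cA).
rewrite (@sign_operator_sum n (fun i => (-1) ^+ i.+1 *: c i)) => [|i].
  by apply: eq_bigr => i _; rewrite signK.
by rewrite rpredZ.
Qed.

Lemma spread_signsK : involutive tau -> involutive spread_signs.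
Proof.
move=> tauK; elim=> // u x IHx /=; rewrite size_spread_signs IHx.
congr (_ :: _); elim: (size x) u => // k IHk u.
by rewrite iterSr iterS tauK IHk.
Qed.

Section Values.
Variable f : seq V -> V.
Hypothesis f_lin : slot_linear f.

Lemma slot_spread_signs d x p : homogeneous A d x ->
  f (p ++ spread_signs x) = (-1) ^+ shift_sign d *: f (p ++ x).
Proof.
elim: d x p => [|e d IHd] [|u x] p //; first by rewrite scale1r.
rewrite homogeneous_cons => /andP[uA dx] /=.
rewrite (iter_sign_operator _ uA) slotZ // -cat_rcons IHd // cat_rcons.
by rewrite scalerA -exprD (homogeneous_size dx).
Qed.

Lemma spread_signs_value d x : homogeneous A d x ->
  f (spread_signs x) = (-1) ^+ shift_sign d *: f x.
Proof. exact: (@slot_spread_signs d x [::]). Qed.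

Lemma map_sign_value d x p q : homogeneous A d x ->
  f (p ++ map tau x ++ q) = (-1) ^+ (sumn d + size d) *: f (p ++ x ++ q).
Proof.
elim: d x p => [|e d IHd] [|u x] p //; first by rewrite scale1r.
rewrite homogeneous_cons => /andP[uA dx] /=.
rewrite (tau_sign uA) slotZ // -cat_rcons IHd // cat_rcons scalerA -exprD.
by congr ((-1) ^+ _ *: _) => /=; lia.
Qed.

Hypothesis f_deg : forall d x, homogeneous A d x ->
  in_degree A ((sumn d)%:Z + 2 - (size x)%:Z) (f x).

Lemma bracket_degree d x : homogeneous A d x -> f x = 0 \/
  exists2 e, f x \in A e & (e + size x = sumn d + 2)%N.
Proof.
move=> /f_deg; case zE: (_ - _) => [e|k] /=; last by left.
by move=> fA; right; exists e => //; lia.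
Qed.

(** Here the exponent r s + t + s (d_1 + ... + d_r) of the definition of the
    relation is accounted for. The value [f x2] only matters through the parity
    of its degree; if that degree is negative both sides are 0. *)
Lemma bracket_term_sign d1 d2 d3 x1 x2 x3 :
  homogeneous A d1 x1 -> homogeneous A d2 x2 -> homogeneous A d3 x3 ->
  (-1) ^+ (size x1 * size x2 + size x3 + size x2 * sumn d1) *:
    f (x1 ++ f x2 :: x3) =
  (-1) ^+ shift_sign (d1 ++ d2 ++ d3) *:
    f (spread_signs (map tau x1 ++ f (spread_signs x2) :: x3)).
Proof.
move=> h1 h2 h3; rewrite (spread_signs_value h2).
have b_lin := spread_signs_slot_linear f_lin.
have := slotZ b_lin (map tau x1) x3 ((-1) ^+ shift_sign d2) (f x2).
rewrite /= => ->.
have [->|[e fA eE]] := bracket_degree h2.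
  by have := slot0 b_lin (map tau x1) x3; rewrite /= => ->; rewrite slot0 // !scaler0.
have h : homogeneous A (d1 ++ e :: d3) (map tau x1 ++ f x2 :: x3).
  rewrite homogeneous_cat ?size_map ?(homogeneous_size h1) //.
  by rewrite homogeneous_cons fA h3 map_sign_homogeneous.
rewrite (spread_signs_value h) (map_sign_value [::] _ h1) !scalerA -!exprD.
congr (_ *: _); apply: signr_parity.
rewrite !shift_sign_cat /= (homogeneous_size h1) (homogeneous_size h2).
rewrite size_cat (homogeneous_size h2) (homogeneous_size h3).
have oe : odd e = odd (sumn d2) (+) odd (size x2).
  have : odd (e + size x2) = odd (sumn d2) by rewrite eE oddD addbF.
  by rewrite oddD => <-; rewrite addbK.
rewrite !(oddD, oddM, oddS) /= oe.
by case: (odd (sumn d1)) (odd (sumn d2)) (odd (size x1)) (odd (size x2))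
  (odd (size x3)) (odd (shift_sign d1)) (odd (shift_sign d2))
  (odd (shift_sign d3)) => [] [] [] [] [] [] [] [].
Qed.

End Values.

Lemma Ainfty_lhs_bracket_relation (m : forall k, ('I_k -> V) -> V) d x :
  slot_linear (multi_app m) ->
  (forall d x, homogeneous A d x ->
    in_degree A ((sumn d)%:Z + 2 - (size x)%:Z) (multi_app m x)) ->
  homogeneous A d x ->
  Ainfty_lhs m d x =
  (-1) ^+ shift_sign d *: bracket_relation tau (multi_app m \o spread_signs) x.
Proof.
move=> f_lin f_deg dx; rewrite /Ainfty_lhs /bracket_relation scaler_sumr.
apply: eq_bigr => r _; rewrite scaler_sumr; apply: eq_bigr => s _.
have rn : (r <= size x)%N by rewrite -ltnS.
have sn : (s <= size x - r)%N by rewrite -ltnS.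
have /andP[h1 h] := homogeneous_take_drop r dx.
have /andP[h2 h3] := homogeneous_take_drop s h.
have dE : d = take r d ++ take s (drop r d) ++ drop s (drop r d).
  by rewrite !cat_take_drop.
have -> : drop (r + s) x = drop s (drop r x) by rewrite drop_drop addnC.
rewrite [in shift_sign d]dE /= -(bracket_term_sign f_lin f_deg h1 h2 h3).
rewrite !size_drop !size_takel ?size_drop //.
Qed.

End Signs.

(** * Unshuffles *)

Section Unshuffles.

(** With [big_perm_lift], this allows induction on permutations by removing
    the first position. *)
Lemma lift_perm_onto n (i0 j0 : 'I_n.+1) (sigma : 'S_n.+1) :
  sigma i0 = j0 -> exists s, lift_perm i0 j0 s = sigma.
Proof.
move=> si0; pose f k := odflt k (unlift j0 (sigma (lift i0 k))).
have fK k : lift j0 (f k) = sigma (lift i0 k).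
  rewrite /f; case: unliftP => [k' ->//|/eqP].
  by rewrite -si0 (inj_eq perm_inj) eq_sym (negPf (neq_lift _ _)).
have f_inj : injective f.
  by move=> k l fkl; apply: (@lift_inj _ i0); apply: (@perm_inj _ sigma); rewrite -!fK fkl.
exists (perm f_inj); apply/permP => k.
case: (unliftP i0 k) => [k'|] ->; last by rewrite lift_perm_id.
by rewrite lift_perm_lift permE fK.
Qed.

Lemma big_perm_lift (W : nmodType) n (i0 j0 : 'I_n.+1) (P : pred 'S_n.+1)
    (G : 'S_n.+1 -> W) :
  \sum_(sigma | P sigma && (sigma i0 == j0)) G sigma =
  \sum_(s : 'S_n | P (lift_perm i0 j0 s)) G (lift_perm i0 j0 s).
Proof.
rewrite (reindex (lift_perm i0 j0)).
  by apply: eq_bigl => s; rewrite lift_perm_id eqxx andbT.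
exists (fun sigma => odflt 1%g [pick s | lift_perm i0 j0 s == sigma]) => sigma.
  move=> _; case: pickP => [s /eqP/permP e|/(_ sigma)]; last by rewrite eqxx.
  apply/permP => k; apply: (@lift_inj _ j0).
  by rewrite -!(lift_perm_lift i0 j0) e.
rewrite inE => /andP[_ /eqP/lift_perm_onto[s ss]].
by case: pickP => [s' /eqP//|/(_ s)]; rewrite ss eqxx.
Qed.

Lemma ltn_bump2 h i j : (bump h i < bump h j)%N = (i < j)%N.
Proof. by rewrite !ltnNge leq_bump2. Qed.

Lemma bump0 i : bump 0 i = i.+1.
Proof. by []. Qed.

Lemma ltn_bump_self h i : (bump h i < h)%N = (i < h)%N.
Proof. by rewrite /bump; lia. Qed.

Lemma leq_self_bump h i : (h <= bump h i)%N = (h <= i)%N.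
Proof. by rewrite /bump; lia. Qed.

Lemma unshuffle_lift0 k n (s : 'S_n) :
  unshuffle k.+1 (lift_perm ord0 ord0 s) = unshuffle k s.
Proof.
apply/forallP/forallP => sP i; apply/forallP => j; apply/implyP.
  move=> ij; have /forallP/(_ (lift ord0 j))/implyP := sP (lift ord0 i).
  by rewrite !lift_permV !lift_perm_lift !lift0 !ltnS => ->.
rewrite lift_permV.
case: (unliftP ord0 i) => [i'|] ->; case: (unliftP ord0 j) => [j'|] -> //.
- rewrite !lift_perm_lift !lift0 !ltnS => ij.
  by have /forallP/(_ j')/implyP := sP i'; apply.
- by rewrite lift_perm_id lift_perm_lift.
Qed.

Lemma unshuffle_lift n (s : 'S_n) (k : 'I_n.+1) :
  unshuffle k (lift_perm ord0 k s) = unshuffle k s.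
Proof.
apply/forallP/forallP => sP i; apply/forallP => j; apply/implyP.
  move=> ij; have /forallP/(_ (lift k j))/implyP := sP (lift k i).
  rewrite !lift_permV !lift_perm_lift /= !ltn_bump2 ltn_bump_self leq_self_bump.
  exact.
rewrite lift_permV.
case: (unliftP k i) => [i'|] ->; case: (unliftP k j) => [j'|] ->.
- rewrite !lift_perm_lift /= !ltn_bump2 ltn_bump_self leq_self_bump => ij.
  by have /forallP/(_ j')/implyP := sP i'; apply.
- by rewrite /= leq_self_bump ltnn ltn_bump_self ltnNge andNb.
- by rewrite lift_perm_id lift_perm_lift.
- by rewrite ltnn.
Qed.

(** The first letter of a shuffle is the first letter of one of the two words,
    which have indices 0 and [k]. *)
Lemma unshuffle_at0 k n (sigma : 'S_n.+1) : unshuffle k sigma ->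
  sigma ord0 = k :> nat \/ (sigma ord0 = ord0 /\ (0 < k)%N).
Proof.
move=> /forallP unsh; case: (unliftP ord0 (sigma ord0)) => [j'|] s0; last first.
  by case: k unsh => [|k] _; [left; rewrite s0|right].
left; apply/eqP; apply: contraT => nk.
have := unsh (inord j'); move=> /forallP/(_ (lift ord0 j'))/implyP.
rewrite -{3}s0 permK ltn0 lift0 inordK; last by rewrite (leq_trans (ltn_ord j')).
move: nk; rewrite s0 lift0 => nk; apply.
by rewrite ltnSn /= -[(k <= j')%N]ltnS -neq_ltn.
Qed.

(** Unshuffles obey the recursion by which [insertions] is defined. *)
Lemma big_unshuffle_rec (W : nmodType) k n (G : 'S_n.+1 -> W) :
  \sum_(sigma : 'S_n.+1 | unshuffle k sigma) G sigma =
  (if k is k'.+1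
   then \sum_(s : 'S_n | unshuffle k' s) G (lift_perm ord0 ord0 s) else 0) +
  (if (k < n.+1)%N
   then \sum_(s : 'S_n | unshuffle k s) G (lift_perm ord0 (inord k) s) else 0).
Proof.
rewrite (bigID (fun sigma : 'S_n.+1 => (sigma ord0 == ord0) && (0 < k)%N)) /=.
congr (_ + _).
  case: k => [|k]; first by rewrite big1 // => i; rewrite !andbF.
  under eq_bigl do rewrite andbT.
  by rewrite big_perm_lift; apply: eq_bigl => s; rewrite unshuffle_lift0.
case: ifP => kn.
  transitivity (\sum_(sigma | unshuffle k sigma && (sigma ord0 == inord k)) G sigma).
    apply: eq_bigl => s; case unsh: (unshuffle k s) => //=.
    rewrite -!val_eqE /= inordK //.
    have [->|[-> k0]] := unshuffle_at0 unsh; first by rewrite eqxx lt0n andbN.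
    by rewrite k0 /= ltn_eqF.
  rewrite big_perm_lift; apply: eq_bigl => s.
  by have := unshuffle_lift s (inord k); rewrite inordK.
rewrite big1 // => s /andP[/unshuffle_at0[sk|[-> ->]]]; last by rewrite eqxx.
by move: (ltn_ord (s ord0)); rewrite sk kn.
Qed.

End Unshuffles.

Lemma nth_nseq_bump (T : Type) (x0 a b : T) k q i :
  nth x0 (nseq k a ++ b :: q) (bump k i) = nth x0 (nseq k a ++ q) i.
Proof.
rewrite !nth_cat !size_nseq ltn_bump_self; have [ik|ki] := ltnP i k.
  by rewrite /bump leqNgt ik add0n.
by rewrite /bump ki add1n subSn.
Qed.

Lemma word_lift_perm (T : Type) (x0 : T) n (j0 : 'I_n.+1) (s : 'S_n) y y' :
  (forall i, nth x0 y (bump j0 i) = nth x0 y' i) ->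
  [seq nth x0 y (lift_perm ord0 j0 s i) | i <- enum 'I_n.+1] =
  nth x0 y j0 :: [seq nth x0 y' (s i) | i <- enum 'I_n].
Proof.
move=> yy'; rewrite enum_ordSl /= lift_perm_id -map_comp; congr (_ :: _).
by apply: eq_map => i /=; rewrite lift_perm_lift yy'.
Qed.

Section ChiRecursion.
Variable K : numFieldType.

(** The value [j0] at position 0 is inverted with the smaller values, all of
    which come later. *)
Lemma koszul_sign_lift n (j0 : 'I_n.+1) (s : 'S_n) (d d' : seq nat) :
  (forall i, nth 0%N d (bump j0 i) = nth 0%N d' i) ->
  koszul_sign K (lift_perm ord0 j0 s) d =
  (\prod_(i < n | (i < j0)%N) (-1) ^+ (nth 0%N d j0 * nth 0%N d' i)) *
  koszul_sign K s d'.
Proof.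
move=> dd'; rewrite /koszul_sign big_ord_recl; congr (_ * _).
  rewrite big_mkcond big_ord_recl ltnn /= mul1r -big_mkcond /=.
  rewrite [RHS](reindex_inj (@perm_inj _ s)) /=.
  apply: eq_big => [i|i _]; rewrite lift_perm_lift lift_perm_id /= ?dd' //.
  by rewrite ltn_bump_self.
apply: eq_bigr => i _.
rewrite big_mkcond big_ord_recl ltn0 /= mul1r -big_mkcond /=.
apply: eq_big => [j|j _]; rewrite !lift_perm_lift /= ?dd' //.
by rewrite !bump0 ltnS ltn_bump2.
Qed.

Lemma chi_lift0 n (s : 'S_n) e d :
  chi K (lift_perm ord0 ord0 s) (e :: d) = chi K s d.
Proof.
rewrite /chi odd_lift_perm (@koszul_sign_lift n ord0 s _ d) //.
by rewrite big_pred0 // mul1r.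
Qed.

(** When the first letter, of degree [e], is moved in front of [k] elements of
    degree 1, each of them contributes -1 from the signature and (-1)^e from
    the Koszul sign. *)
Lemma chi_lift k n (s : 'S_n) (j0 : 'I_n.+1) e d : val j0 = k ->
  chi K (lift_perm ord0 j0 s) (nseq k 1%N ++ e :: d) =
  (-1) ^+ (k * e.+1) * chi K s (nseq k 1%N ++ d).
Proof.
move=> j0k; rewrite /chi odd_lift_perm /= j0k.
rewrite (@koszul_sign_lift n j0 s _ (nseq k 1%N ++ d)); last first.
  by move=> i; rewrite j0k nth_nseq_bump.
rewrite j0k nth_cat size_nseq ltnn subnn /=.
have -> : \prod_(i < n | (i < k)%N)
    (-1) ^+ (e * nth 0%N (nseq k 1%N ++ d) i) = (-1) ^+ (e * k) :> K.
  under eq_bigr => i ik do rewrite nth_cat size_nseq ik nth_nseq ik muln1.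
  have le_kn : (k <= n)%N by rewrite -j0k -ltnS ltn_ord.
  by rewrite -(big_ord_widen n (fun=> (-1) ^+ e)) // prodr_const card_ord -exprM.
rewrite signr_addb mulrACA; congr (_ * _).
by rewrite signr_odd -exprD mulnS [(e * k)%N]mulnC.
Qed.

End ChiRecursion.

(** * The twisted terms as sums over insertions *)

Lemma multi_app_size (K : numFieldType) (V : lmodType K)
    (m : forall k, ('I_k -> V) -> V) N (w : seq V) : size w = N ->
  multi_app m w = m N (fun i => w`_i).
Proof. by case: _ /. Qed.

Section TwistedTerms.
Variables (K : numFieldType) (V : lmodType K) (A : nat -> submodClosed V).
Variable tau : V -> V.
Hypothesis tau_sign : forall i v, v \in A i -> tau v = (-1) ^+ i.+1 *: v.
Variable g : V.
Hypothesis g_deg1 : g \in A 1%N.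

Lemma tau_degree1 : tau g = g.
Proof. by rewrite (tau_sign g_deg1) sqrrN expr1n scale1r. Qed.

Lemma iter_tau_degree1 k : iter k tau g = g.
Proof. by elim: k => //= k ->; exact: tau_degree1. Qed.

Section Sums.
Variable f : seq V -> V.
Hypothesis f_lin : slot_linear f.

(** By induction on the first letter of the shuffled word. If it is a letter of
    degree [e] of [x], its sign in chi is (-1)^(k (e + 1)) by [chi_lift], its
    sign in [shift_sign] is (-1)^((size x - 1) (e + 1)), and their product is
    the effect of the tau^(k + size x - 1) which [spread_signs] applies to it.
    If it is [g], there is no sign on either side. The prefix [p] collects the
    letters already processed. *)
Lemma sum_unshuffle_insertions N k d x p :
  homogeneous A d x -> N = (k + size x)%N ->
  (-1) ^+ shift_sign d *: \sum_(s : 'S_N | unshuffle k s)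
    chi K s (nseq k 1%N ++ d) *:
      f (p ++ [seq (nseq k g ++ x)`_(s i) | i <- enum 'I_N]) =
  \sum_(w <- insertions g k x) f (p ++ spread_signs tau w).
Proof.
elim: N k d x p => [|N IHN] k d x p dx Nkx.
  case: k x d Nkx dx => [|k] [|u x] [|e d] //= _ _.
  rewrite big_seq1 scale1r (big_pred1 1%g) => [|s].
    rewrite /chi /koszul_sign odd_perm1 big_ord0 mulr1 scale1r.
    by rewrite (size0nil (s := enum 'I_0)) // size_enum_ord.
  rewrite [RHS](_ : _ = true); last by apply/eqP/permP => -[].
  by apply/forallP => -[].
rewrite big_unshuffle_rec scalerDr.
have first_g k' d' x' : homogeneous A d' x' -> N = (k' + size x')%N ->
  (-1) ^+ shift_sign d' *: \sum_(s : 'S_N | unshuffle k' s)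
    chi K (lift_perm ord0 ord0 s) (nseq k'.+1 1%N ++ d') *:
      f (p ++ [seq (nseq k'.+1 g ++ x')`_(lift_perm ord0 ord0 s i) | i <- enum 'I_N.+1])
  = \sum_(w <- insertions g k' x') f (p ++ g :: spread_signs tau w).
  move=> dx' Nkx'; under [RHS]eq_bigr do rewrite -cat_rcons.
  rewrite -(IHN _ _ _ _ dx' Nkx'); congr (_ *: _); apply: eq_bigr => s _.
  by rewrite chi_lift0 (@word_lift_perm _ 0 _ ord0 s _ (nseq k' g ++ x')) // cat_rcons.
case: x d dx Nkx => [|u x] [|e d] // dx Nkx.
  case: k Nkx => [|k] //; rewrite addn0 => -[Nk].
  have -> : insertions g k.+1 [::] = map (cons g) (insertions g k [::]) by [].
  rewrite Nk ltnn scaler0 addr0 -Nk big_map first_g ?addn0 //.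
  by apply: eq_bigr => w _; rewrite /= iter_tau_degree1.
move: (dx); rewrite homogeneous_cons => /andP[uA dx'].
have Nkx' : N = (k + size x)%N by move: Nkx; rewrite addnS => -[].
have kN : (k < N.+1)%N by rewrite Nkx' ltnS leq_addr.
have first_u :
  (-1) ^+ (size d * e.+1 + shift_sign d) *:
    \sum_(s : 'S_N | unshuffle k s)
    chi K (lift_perm ord0 (inord k) s) (nseq k 1%N ++ e :: d) *:
      f (p ++ [seq (nseq k g ++ u :: x)`_(lift_perm ord0 (inord k) s i)
                 | i <- enum 'I_N.+1]) =
  \sum_(w <- insertions g k x) f (p ++ spread_signs tau (u :: w)).
  transitivity ((-1) ^+ (N * e.+1) *:
      \sum_(w <- insertions g k x) f (rcons p u ++ spread_signs tau w)).
    rewrite -(IHN _ _ _ _ dx' Nkx') scalerA !scaler_sumr; apply: eq_bigr => s _.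
    rewrite (@chi_lift K k N s (inord k) e d (inordK kN)).
    rewrite (@word_lift_perm _ 0 _ (inord k) s _ (nseq k g ++ x)) => [|i].
      rewrite inordK // nth_cat size_nseq ltnn subnn cat_rcons !scalerA mulrA.
      rewrite -!exprD; congr ((_ ^+ _ * _) *: _).
      by rewrite Nkx' (homogeneous_size dx'); lia.
    by rewrite inordK // nth_nseq_bump.
  rewrite scaler_sumr [RHS]big_seq [LHS]big_seq; apply: eq_bigr => w win.
  rewrite /= (iter_sign_operator tau_sign _ uA) slotZ // cat_rcons.
  by rewrite (size_insertions win) -Nkx'.
rewrite kN first_u.
case: k Nkx {Nkx' kN first_u} => [|k] Nkx.
  by rewrite scaler0 add0r insertions0 !big_seq1.
rewrite (first_g k (e :: d) (u :: x)) //; last by case: Nkx.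
rewrite big_insertions_cons addrC; congr (_ + _).
by apply: eq_bigr => w _; rewrite /= iter_tau_degree1.
Qed.

End Sums.

Lemma multi_app_enum (m : forall k, ('I_k -> V) -> V) N (F : 'I_N -> V) :
  multi_app m [seq F i | i <- enum 'I_N] = m N F.
Proof.
have wN : size [seq F i | i <- enum 'I_N] = N by rewrite size_map size_enum_ord.
rewrite (multi_app_size _ wN); apply: (congr1 (m N)); apply/funext => i.
by rewrite (nth_map i) ?size_enum_ord // nth_ord_enum.
Qed.

Lemma twisted_term_insert_sum (m : forall k, ('I_k -> V) -> V) d x k :
  slot_linear (multi_app m) -> homogeneous A d x ->
  twisted_term m g d x k =
  (-1) ^+ shift_sign d *: insert_sum (multi_app m \o spread_signs tau) g k x.
Proof.
move=> m_lin dx; have := sum_unshuffle_insertions m_lin [::] dx erefl.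
rewrite /insert_sum /twisted_term; case: x d dx => [|u x] [|e d] // dx.
  move=> _; rewrite scale1r big_insertions_nil /=; congr multi_app.
  by elim: k => //= k <-; rewrite iter_tau_degree1.
move=> <-; rewrite signK; apply: eq_bigr => s _.
by rewrite /= (multi_app_enum m (fun i => (nseq k g ++ u :: x)`_(s i))).
Qed.

End TwistedTerms.

(** * Multilinear maps on lists of arguments *)

Lemma nth_slot_dfwith (V : zmodType) (p q : seq V) (u : V) N
    (i0 : 'I_N) : val i0 = size p ->
  (fun i : 'I_N => (p ++ u :: q)`_i) =
  dfwith (fun i : 'I_N => (p ++ 0 :: q)`_i) i0 u.
Proof.
move=> i0p; apply/funext => i; have [->|ii0] := eqVneq i i0.
  by rewrite dfwithin i0p nth_cat ltnn subnn.
rewrite dfwithout 1?eq_sym // !nth_cat; case: ltnP => // pi.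
have : (size p < i)%N by rewrite ltn_neqAle pi -i0p andbT eq_sym.
by rewrite -subn_gt0; case: (i - size p)%N.
Qed.

Lemma multilinear_slot_linear (K : numFieldType) (V : lmodType K)
    (m : forall k, ('I_k -> V) -> V) :
  (forall k, multilinear (m k)) -> slot_linear (multi_app m).
Proof.
move=> m_lin p q a u v.
have pN : (size p < size (p ++ 0%R :: q))%N by rewrite size_cat /= addnS ltnS leq_addr.
have app w : multi_app m (p ++ w :: q) =
    m _ (dfwith (fun i : 'I_(size (p ++ 0 :: q)) => (p ++ 0 :: q)`_i) (Ordinal pN) w).
  by rewrite (@multi_app_size _ _ _ (size (p ++ 0 :: q))) ?size_cat //
     -(@nth_slot_dfwith _ p q w _ (Ordinal pN) erefl).
by rewrite !app m_lin.
Qed.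

Lemma continuous_slot_bounded_on (K : numFieldType)
    (V : completeNormedModType K) (m : forall k, ('I_k -> V) -> V) :
  (forall k, multilinear (m k)) ->
  (forall k, continuous (m k : {ptws 'I_k -> V} -> V)) ->
  forall p q, bounded_on predT (fun u => multi_app m (p ++ u :: q)).
Proof.
move=> m_lin m_cont p q; apply: linear_continuous_bounded_on.
  exact: (multilinear_slot_linear m_lin).
have pN : (size p < size (p ++ 0%R :: q))%N by rewrite size_cat /= addnS ltnS leq_addr.
pose N := size (p ++ 0 :: q).
have -> : (fun u => multi_app m (p ++ u :: q)) =
   (m N : {ptws 'I_N -> V} -> V) \o
   (dfwith (fun i : 'I_N => (p ++ 0 :: q)`_i) (Ordinal pN)).
  apply/funext => u; rewrite (@multi_app_size _ _ _ N) /=; last by rewrite /N !size_cat.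
  by rewrite -(@nth_slot_dfwith _ p q u _ (Ordinal pN) erefl).
move=> u; apply: continuous_comp; last exact: m_cont.
exact: dfwith_continuous.
Qed.

Lemma slot_linear_multilinear (K : numFieldType) (V : lmodType K)
    (F : seq V -> V) k :
  slot_linear F -> multilinear (fun x : 'I_k -> V => F [seq x i | i <- enum 'I_k]).
Proof.
move=> F_lin x i a u v.
have word w : [seq dfwith x i w j | j <- enum 'I_k] =
   take i [seq x j | j <- enum 'I_k] ++ w :: drop i.+1 [seq x j | j <- enum 'I_k].
  have sz : size [seq x j | j <- enum 'I_k] = k by rewrite size_map size_enum_ord.
  apply: (@eq_from_nth _ 0).
    rewrite size_map size_enum_ord size_cat /= size_drop sz size_takel ?sz //.
      by rewrite -subSn // subnKC // ltnW.
    exact: ltnW.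
  move=> j; rewrite size_map size_enum_ord => jk.
  rewrite (nth_map i) ?size_enum_ord // nth_cat size_takel ?sz; last exact: ltnW.
  have nthj : nth i (enum 'I_k) j = Ordinal jk by apply: val_inj; rewrite /= nth_enum_ord.
  rewrite nthj; have [ji|ij|ji] := ltngtP j i.
  - rewrite dfwithout; last by rewrite -val_eqE /= gtn_eqF.
    by rewrite nth_take // (nth_map i) ?size_enum_ord // nthj.
  - rewrite dfwithout; last by rewrite -val_eqE /= ltn_eqF.
    rewrite -[(j - i)%N]prednK ?subn_gt0 //= nth_drop.
    have -> : (i.+1 + (j - i).-1)%N = j by lia.
    by rewrite (nth_map i) ?size_enum_ord // nthj.
  - have -> : Ordinal jk = i by apply: val_inj.
    by rewrite dfwithin ji subnn.
by rewrite !word F_lin.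
Qed.

Lemma nth_word (V : zmodType) (x : seq V) :
  [seq x`_(nat_of_ord i) | i <- enum 'I_(size x)] = x.
Proof.
apply: (@eq_from_nth _ 0) => [|j]; rewrite size_map size_enum_ord // => jx.
by rewrite (nth_map (Ordinal jx)) ?size_enum_ord // nth_enum_ord.
Qed.

(** * Degrees of insertions *)

Section InDegree.
Variables (K : numFieldType) (V : lmodType K) (A : nat -> submodClosed V).

Lemma in_degree_sum z I (r : seq I) (F : I -> V) :
  (forall i, in_degree A z (F i)) -> in_degree A z (\sum_(i <- r) F i).
Proof.
case: z => n FA /=; first by apply: rpred_sum => i _; exact: FA.
by apply: big1 => i _; exact: FA.
Qed.

Lemma insertions_homogeneous g k d x w : g \in A 1%N -> homogeneous A d x ->
  w \in insertions g k x ->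
  exists2 dw, homogeneous A dw w & sumn dw = (k + sumn d)%N.
Proof.
move=> gA; elim: k d x w => [|k IHk] d x w.
  by rewrite insertions0 inE => dx /eqP->; exists d.
elim: x d w => [|u x IHx] [|e d] w // dx.
  have -> : insertions g k.+1 [::] = map (cons g) (insertions g k [::]) by [].
  move=> /mapP[v /(IHk _ _ _ dx)[dv vA dvE] ->].
  by exists (1%N :: dv); rewrite ?homogeneous_cons ?gA //= dvE.
rewrite insertions_cons mem_cat => /orP[]/mapP[v].
  move: dx; rewrite homogeneous_cons => /andP[uA dx] /(IHx _ _ dx)[dv vA dvE] ->.
  by exists (e :: dv); rewrite ?homogeneous_cons ?uA //= dvE addnCA.
move=> /(IHk _ _ _ dx)[dv vA dvE] ->.
by exists (1%N :: dv); rewrite ?homogeneous_cons ?gA //= dvE.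
Qed.

End InDegree.

(** * Convergence and the relation for the twisted brackets *)

Section TwistedStructure.
Variables (K : numFieldType) (V : completeNormedModType K).
Variable A : nat -> submodClosed V.
Hypothesis K_arch : archimedean_scalars K.
Hypothesis A_grading : is_grading A.
Hypothesis A_closed : forall i, closed [set v : V | v \in A i].
Variable tau : V -> V.
Hypothesis tau_linear : linear tau.
Hypothesis tau_sign : forall i v, v \in A i -> tau v = (-1) ^+ i.+1 *: v.
Variable f : seq V -> V.
Hypothesis f_lin : slot_linear f.
Hypothesis f_bounded : forall p q, bounded_on predT (fun u => f (p ++ u :: q)).
Hypothesis f_deg : forall d x, homogeneous A d x ->
  in_degree A ((sumn d)%:Z + 2 - (size x)%:Z) (f x).
Variable g : V.
Hypothesis g_deg1 : g \in A 1%N.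

Let b := f \o spread_signs tau.
Let T := insert_sum b g.

Hypothesis b_relation : forall d x, homogeneous A d x ->
  bracket_relation tau b x = 0.
Hypothesis T_cvg_homogeneous : forall d x, homogeneous A d x ->
  cvgn (series (T ^~ x)).

Let b_lin : slot_linear b.
Proof. exact: spread_signs_slot_linear. Qed.

Let T_lin k : slot_linear (T k).
Proof. exact: insert_sum_slot_linear. Qed.

(** Each argument is a finite sum of homogeneous elements; the arguments are
    split one after the other, those in [p] being already homogeneous. *)
Lemma insert_sum_cvg x : cvgn (series (T ^~ x)).
Proof.
suff gen p d : homogeneous A d p -> cvgn (series (T ^~ (p ++ x))) by exact: (gen [::] [::]).
elim: x p d => [|u x IHx] p d dp; first by rewrite cats0; exact: T_cvg_homogeneous dp.
have [dec _] := A_grading; have [n [c [cA ->]]] := dec u.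
elim: n => [|n IHn].
  have -> : T ^~ (p ++ \sum_(i < 0) c i :: x) = fun=> 0.
    by apply/funext => k; rewrite big_ord0 slot0.
  have -> : series (fun=> 0 : V) = fun=> 0.
    by apply/funext => k; rewrite /series /= big1.
  exact: is_cvg_cst.
have -> : T ^~ (p ++ \sum_(i < n.+1) c i :: x) =
    (T ^~ (p ++ \sum_(i < n) c i :: x)) + (T ^~ (rcons p (c n) ++ x)).
  by apply/funext => k; rewrite big_ord_recr slotD // cat_rcons.
rewrite seriesD; apply: is_cvgD => //; apply: (IHx _ (rcons d n)).
by rewrite -!cats1 homogeneous_cat ?(homogeneous_size dp) // dp homogeneous_cons cA.
Qed.

Definition twisted_bracket (x : seq V) : V := limn (series (T ^~ x)).

Lemma twisted_bracket_cvg x : series (T ^~ x) @ \oo --> twisted_bracket x.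
Proof. exact: insert_sum_cvg. Qed.

Lemma twisted_bracket_slot_linear : slot_linear twisted_bracket.
Proof.
move=> p q a u v; apply: cvg_lim; first exact: norm_hausdorff.
have -> : T ^~ (p ++ (a *: u + v) :: q) =
    a *: (T ^~ (p ++ u :: q)) + (T ^~ (p ++ v :: q)).
  by apply/funext => k; rewrite T_lin.
rewrite seriesD seriesZ; apply: cvgD; last exact: twisted_bracket_cvg.
by apply: cvgZl_tmp; exact: twisted_bracket_cvg.
Qed.

Lemma insert_sum_degree d x k : homogeneous A d x ->
  in_degree A ((sumn d)%:Z + 2 - (size x)%:Z) (T k x).
Proof.
move=> dx; rewrite /T /insert_sum big_seq_cond big_mkcond /=.
apply: in_degree_sum => w; case: ifP => [/andP[wx _]|_]; last first.
  by case: (_ - _) => n //=; rewrite rpred0.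
have [dw dwA dwE] := insertions_homogeneous g_deg1 dx wx.
have := f_deg dwA; rewrite (size_insertions wx) dwE.
have -> : (k + sumn d)%N%:Z + 2 - (k + size x)%N%:Z =
   (sumn d)%:Z + 2 - (size x)%:Z by lia.
rewrite /b /= (spread_signs_value tau_sign f_lin dwA).
by case: (_ - _) => n /= => [fA|->]; rewrite ?rpredZ ?scaler0.
Qed.

(** The degree sum d + 2 - n does not involve the number of inserted elements,
    as these have degree 1. If it is negative the values are 0, and any graded
    piece contains them. *)
Lemma insert_sum_degree_nat d x : homogeneous A d x ->
  exists e, forall k, T k x \in A e.
Proof.
move=> dx; have := fun k => insert_sum_degree k dx.
case: (_ - _) => n Tn; first by exists n.
by exists 0 => k; rewrite [T k x]Tn rpred0.
Qed.

Lemma twisted_bracket_degree d x : homogeneous A d x ->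
  in_degree A ((sumn d)%:Z + 2 - (size x)%:Z) (twisted_bracket x).
Proof.
move=> dx; have := fun k => insert_sum_degree k dx; have := @twisted_bracket_cvg x.
case: (_ - _) => n Tcvg Tn /=.
  apply: (closed_cvg (fun v => v \in A n) (@A_closed n) _ _ Tcvg).
  by apply: nearW => k; apply: rpred_sum => i _; exact: Tn.
rewrite /twisted_bracket; have -> : series (T ^~ x) = fun=> 0.
  by apply/funext => k; apply: big1 => i _; exact: Tn.
exact: lim_cst.
Qed.

(** [tau] need not be continuous on [V], but on one graded piece it is a sign. *)
Lemma bracket_bounded_on e p q : bounded_on (A e) (fun u => b (p ++ u :: q)).
Proof.
have [p' p'P] := spread_signs_cat tau p (size q).+1.
have [C C0 fC] := f_bounded p' (spread_signs tau q).
exists C => // u uA; rewrite /b /= p'P //= (iter_sign_operator tau_sign _ uA).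
by rewrite slotZ // normrZ normrX normrN1 expr1n mul1r fC.
Qed.

Lemma partial_sums_uniform_bound e p q :
  uniform_bound (A e) (fun i u => \sum_(k < i) T k (p ++ u :: q)).
Proof.
apply: uniform_boundedness => //.
- move=> i a u v; rewrite scaler_sumr -big_split; apply: eq_bigr => k _.
  exact: T_lin.
- move=> i; rewrite /bounded_on; apply: bounded_on_sum => k.
  have -> : (fun u => T k (p ++ u :: q)) = (fun u =>
    \sum_(i < k.+1) \sum_(w <- insertions g i p)
      \sum_(v <- insertions g (k - i) q) b (w ++ u :: v)).
    by apply/funext => u; rewrite /T insert_sum_cat.
  apply: bounded_on_sum => j; apply: bounded_on_sum => w.
  by apply: bounded_on_sum => v; exact: bracket_bounded_on.
- move=> u _; have [n nP] := cvgn_bounded K_arch (@twisted_bracket_cvg (p ++ u :: q)).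
  by exists n => k; have := nP k; rewrite /series /= big_mkord.
Qed.

(** This is where uniform boundedness is needed: the inner partial sums vary
    inside the closed subspace A_e, and the outer partial sums are
    equicontinuous there. *)
Lemma nested_double_limit d2 p x2 q : homogeneous A d2 x2 ->
  bounded_double_limit
    (fun i j => \sum_(k < i) \sum_(l < j) T k (p ++ T l x2 :: q))
    (twisted_bracket (p ++ twisted_bracket x2 :: q)).
Proof.
move=> dx2; have [e Te] := insert_sum_degree_nat dx2.
have -> : (fun i j => \sum_(k < i) \sum_(l < j) T k (p ++ T l x2 :: q)) =
    (fun i j => (fun i u => \sum_(k < i) T k (p ++ u :: q)) i (\sum_(l < j) T l x2)).
  apply/funext => i; apply/funext => j; apply: eq_bigr => k _.
  by rewrite slot_sum.
have ycvg : (fun j => \sum_(l < j) T l x2) @ \oo --> twisted_bracket x2.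
  have -> : (fun j => \sum_(l < j) T l x2) = series (T ^~ x2).
    by apply/funext => j; rewrite /series /= big_mkord.
  exact: twisted_bracket_cvg.
have yA j : \sum_(l < j) T l x2 \in A e by rewrite rpred_sum.
apply: (@uniform_bound_double_limit _ _ _ (A e)
  (fun i u => \sum_(k < i) T k (p ++ u :: q)) _ (twisted_bracket x2)) => //.
- move=> i a u v; rewrite scaler_sumr -big_split; apply: eq_bigr => k _.
  exact: T_lin.
- exact: partial_sums_uniform_bound.
- apply: (closed_cvg (fun v => v \in A e) (@A_closed e) _ _ ycvg).
  exact: nearW.
- have -> : (fun i => \sum_(k < i) T k (p ++ twisted_bracket x2 :: q)) =
      series (T ^~ (p ++ twisted_bracket x2 :: q)).
    by apply/funext => i; rewrite /series /= big_mkord.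
  exact: twisted_bracket_cvg.
Qed.

(** The double series of the relation has vanishing antidiagonal sums, by
    algebra, and its rectangular partial sums have the left-hand side of the
    relation as a limit, by analysis; so this limit is 0. *)
Lemma twisted_bracket_relation d x : homogeneous A d x ->
  bracket_relation tau twisted_bracket x = 0.
Proof.
move=> dx.
pose a k l := \sum_(r < (size x).+1) \sum_(s < (size x - r).+1)
  T k (map tau (take r x) ++ T l (take s (drop r x)) :: drop (r + s) x).
have diag0 N : \sum_(l < N.+1) a (N - l)%N l = 0.
  rewrite /a exchange_big /=; under eq_bigr do rewrite exchange_big /=.
  rewrite -bracket_relation_insertions ?(tau_degree1 tau_sign) //.
  rewrite big_seq big1 // => w /(insertions_homogeneous g_deg1 dx)[dw dwA _].
  exact: b_relation dwA.
apply: (bounded_double_limit_antidiagonal K_arch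
  (F := fun i j => \sum_(k < i) \sum_(l < j) a k l)); last exact: square_partial_sums_cancel.
have -> : (fun i j => \sum_(k < i) \sum_(l < j) a k l) = (fun i j =>
    \sum_(r < (size x).+1) \sum_(s < (size x - r).+1) \sum_(k < i) \sum_(l < j)
      T k (map tau (take r x) ++ T l (take s (drop r x)) :: drop (r + s) x)).
  apply/funext => i; apply/funext => j.
  under eq_bigr do rewrite exchange_big /=.
  rewrite exchange_big; apply: eq_bigr => r _ /=.
  under eq_bigr do rewrite exchange_big /=.
  by rewrite exchange_big.
apply: bounded_double_limit_sum => r; apply: bounded_double_limit_sum => s.
have /andP[_ h] := homogeneous_take_drop r dx.
have /andP[h2 _] := homogeneous_take_drop s h.
exact: nested_double_limit h2.
Qed.

End TwistedStructure.

(** * The twisted curved structure *)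

Theorem proposition2p14 (R : realType) (K : numFieldType)
    (K_real_or_complex : real_or_complex R K)
    (V : completeNormedModType K)
    (A : nat -> submodClosed V)
    (A_grading : is_grading A)
    (A_closed : forall i, closed [set v : V | v \in A i])
    (m : forall k, ('I_k -> V) -> V)
    (m_Ainfty : curved_Ainfty A m)
    (m_continuous : forall k, continuous (m k : {ptws 'I_k -> V} -> V))
    (gamma : V) (gamma_deg1 : gamma \in A 1%N)
    (twisted_cvg : forall (d : seq nat) (x : seq V), homogeneous A d x ->
       cvgn (series (twisted_term m gamma d x))) :
  exists mg : forall k, ('I_k -> V) -> V,
    (forall (d : seq nat) (x : seq V), homogeneous A d x ->
       series (twisted_term m gamma d x) @ \oo --> multi_app mg x) /\
    curved_Ainfty A mg.
Proof.
have K_arch := real_or_complex_archimedean K_real_or_complex.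
have [m_lin m_deg m_rel] := m_Ainfty.
have f_lin := multilinear_slot_linear m_lin.
have f_bounded := continuous_slot_bounded_on m_lin m_continuous.
have [tau tau_linear tau_sign] := grading_sign_operator A_grading.
have tauK := sign_operatorK tau_linear tau_sign A_grading.
pose b := multi_app m \o spread_signs tau.
have twistedE d x : homogeneous A d x -> twisted_term m gamma d x =
    (-1) ^+ shift_sign d *: (insert_sum b gamma ^~ x).
  move=> dx; apply/funext => k.
  by rewrite (twisted_term_insert_sum tau_sign gamma_deg1 k f_lin dx).
have b_rel d x : homogeneous A d x -> bracket_relation tau b x = 0.
  move=> dx; rewrite -[LHS](@signK _ _ (shift_sign d)).
  rewrite -(Ainfty_lhs_bracket_relation tau_linear tau_sign f_lin m_deg dx).
  by rewrite m_rel // scaler0.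
have T_cvg d x : homogeneous A d x -> cvgn (series (insert_sum b gamma ^~ x)).
  move=> dx; have -> : insert_sum b gamma ^~ x =
      (-1) ^+ shift_sign d *: twisted_term m gamma d x.
    by rewrite twistedE //; apply/funext => k /=; rewrite [RHS]signK.
  by rewrite seriesZ; apply: is_cvgZl_tmp; exact: twisted_cvg.
(* B is the suspended twisted structure; since tau is an involution, F is the
   structure whose suspension is B. *)
pose B := twisted_bracket tau (multi_app m) gamma.
have B_lin : slot_linear B by exact: (@twisted_bracket_slot_linear _ _ A).
pose F := B \o spread_signs tau.
have F_lin : slot_linear F by exact: spread_signs_slot_linear.
pose mg k (x : 'I_k -> V) := F [seq x i | i <- enum 'I_k].
have mgE : multi_app mg = F by apply/funext => x; rewrite /multi_app /mg nth_word.
have F_deg d x : homogeneous A d x ->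
    in_degree A ((sumn d)%:Z + 2 - (size x)%:Z) (F x).
  move=> dx; rewrite /F /= (spread_signs_value tau_sign B_lin dx).
  have : in_degree A ((sumn d)%:Z + 2 - (size x)%:Z) (B x).
    exact: (twisted_bracket_degree A_grading A_closed tau_linear tau_sign).
  by case: (_ - _) => n /= => [BA|->]; rewrite ?rpredZ ?scaler0.
exists mg; split=> [d x dx|].
  rewrite twistedE // seriesZ mgE /F /=.
  rewrite (spread_signs_value tau_sign B_lin dx).
  apply: cvgZl_tmp; apply: (twisted_bracket_cvg A_grading) => //.
split=> [k|d x dx|d x dx].
- exact: slot_linear_multilinear.
- by rewrite mgE; exact: F_deg.
- rewrite (Ainfty_lhs_bracket_relation tau_linear tau_sign) ?mgE //.
  have -> : F \o spread_signs tau = B.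
    by apply/funext => y; rewrite /F /= spread_signsK.
  rewrite (twisted_bracket_relation K_arch A_grading A_closed tau_linear
    tau_sign f_lin f_bounded m_deg gamma_deg1 b_rel T_cvg dx).
  by rewrite scaler0.
Qed.
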